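(* For every integer $m\ge 0$ and every complex $s$ with $0<\mathrm{Re}(s)<1$, $$\int_0^{+\infty}t^{s-1}\Psi_m(t)\,dt=\frac{1}{\sqrt{2\pi}}\,\Gamma\!\left(\frac s2\right)\Gamma\!\left(\frac{1-s}2\right)Q_m(s).$$
   Context: For an integer $m\ge 0$ and $t\in\,]0,+\infty[$, $\Psi_m(t)=\sqrt2\left(\frac{t^2-1}{t^2+1}\right)^m\frac{1}{\sqrt{1+t^2}}$. The Hermite polynomials $H_m$ are defined by $e^{-t^2+2xt}=\sum_{m\ge0}\frac{H_m(x)}{m!}t^m$, and $\Phi_m(x)=H_m(\sqrt{2\pi}\,x)e^{-\pi x^2}$. The polynomials $Q_m\in\mathbb{R}[X]$ are defined by the Mellin transforms of the even Hermite functions: for $\mathrm{Re}(s)>0$, $\int_0^{+\infty}\frac{\Phi_{2m}(x)}{(2m)!}x^{s-1}dx=\frac12\pi^{-s/2}\Gamma(s/2)\frac{Q_m(s)}{m!}$. Explicitly, $Q_m(s)=\sum_{k=0}^m(-1)^{m-k}\frac{m!}{(m-k)!}\frac{2^{2k}}{(2k)!}\,s(s+2)\cdots(s+2(k-1))$ (the empty product for $k=0$ being $1$). *)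

(* Defs.v *)
(* MathComp + MathComp-Analysis, over an arbitrary R : realType; the complex
   numbers are R[i] (mathcomp-real-closed). *)
From mathcomp Require Export all_boot all_order all_algebra.
From mathcomp Require Export all_classical all_reals all_analysis.
From mathcomp Require Export complex.
Export Order.TTheory GRing.Theory Num.Theory.
Export numFieldNormedType.Exports.

Set Implicit Arguments.
Unset Strict Implicit.
Unset Printing Implicit Defensive.

Local Open Scope classical_set_scope.
Local Open Scope complex_scope.
Local Open Scope ring_scope.

(* x ^ s := e^(s ln x); only meaningful for x > 0. *)
Definition cpow (R : realType) (x : R) (s : R[i]) : R[i] :=
  (expR (complex.Re s * ln x))%:C *
  (cos (complex.Im s * ln x) +i* sin (complex.Im s * ln x)).

(* Lebesgue integrals of complex-valued functions over ]0, +oo[.  As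
   Rintegral is total, equalities between integrals are always paired below
   with absolute convergence, cintegrable. *)
Definition cintegrable (R : realType) (F : R -> R[i]) : Prop :=
  lebesgue_measure.-integrable `]0%R, +oo[ (fun t => (complex.Re (F t))%:E) /\
  lebesgue_measure.-integrable `]0%R, +oo[ (fun t => (complex.Im (F t))%:E).

Definition cintegral (R : realType) (F : R -> R[i]) : R[i] :=
  (\int[lebesgue_measure]_(t in `]0%R, +oo[) complex.Re (F t)) +i*
  (\int[lebesgue_measure]_(t in `]0%R, +oo[) complex.Im (F t)).

Definition mellin_integrand (R : realType) (f : R -> R) (s : R[i]) :
    R -> R[i] :=
  fun t => cpow t (s - 1) * (f t)%:C.

Definition mellin_integrable (R : realType) (f : R -> R) (s : R[i]) : Prop :=
  cintegrable (mellin_integrand f s).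

Definition mellin (R : realType) (f : R -> R) (s : R[i]) : R[i] :=
  cintegral (mellin_integrand f s).

(* Euler's integral, hence Gamma only on the half-plane Re z > 0. *)
Definition Gamma (R : realType) (z : R[i]) : R[i] :=
  mellin (fun t : R => expR (- t)) z.

Definition Psi (R : realType) (m : nat) (t : R) : R :=
  Num.sqrt 2 * ((t ^+ 2 - 1) / (t ^+ 2 + 1)) ^+ m / Num.sqrt (1 + t ^+ 2).

(* e^(- t^2 + 2 x t) = \sum_m H_m(x) / m! t^m : as the left-hand side is entire
   in t, H_m(x) is its m-th derivative in t at 0. *)
Definition hermite (R : realType) (m : nat) (x : R) : R :=
  derive1n m (fun t : R => expR (- t ^+ 2 + 2 * x * t)) 0.

Definition Phi (R : realType) (m : nat) (x : R) : R :=
  hermite m (Num.sqrt (2 * pi) * x) * expR (- (pi * x ^+ 2)).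

Definition ceval (R : realType) (Q : {poly R}) (s : R[i]) : R[i] :=
  (map_poly (real_complex R) Q).[s].

Definition is_mellin_poly (R : realType) (m : nat) (Q : {poly R}) : Prop :=
  forall s : R[i], 0 < complex.Re s ->
    let f := fun x : R => Phi m.*2 x / (m.*2)`!%:R in
    mellin_integrable f s /\
    mellin f s =
      2^-1 * cpow pi (- s / 2) * Gamma (s / 2) * (ceval Q s / m`!%:R).

(* Q_m, "the" polynomial satisfying is_mellin_poly (unique since Gamma > 0 on
   the positive reals).  The default 0 does not satisfy it, so existence is not
   taken for granted: it has to be established to say anything useful on
   Qpoly R m.  Explicitly,
   Q_m(s) = \sum_(k <= m) (-1)^(m-k) m!/(m-k)! 2^(2k)/(2k)! s(s+2)...(s+2(k-1)). *)
Definition Qpoly (R : realType) (m : nat) : {poly R} :=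
  xget 0 [set Q : {poly R} | is_mellin_poly m Q].

(* Main.v *)
Require Import Defs.
From mathcomp Require Import ring lra measurable_realfun.

Set Implicit Arguments.
Unset Strict Implicit.
Unset Printing Implicit Defensive.

Local Open Scope classical_set_scope.
Local Open Scope complex_scope.
Local Open Scope ring_scope.

(* Expanding ((t^2 - 1)/(t^2 + 1))^m = (-1 + 2 t^2/(1 + t^2))^m writes Psi_m as
   a combination of the functions t^(2k) (1 + t^2)^(-(2k+1)/2).  Their Mellin
   transforms are Beta integrals: for 0 < Re z < w, integrating
   t^(z-1) v^(w-1) e^(-(1 + t^2) v^2) in both orders gives
     Gamma(w/2) * int t^(z-1) (1 + t^2)^(-w/2) dt
       = Gamma(z/2) Gamma((w - z)/2) / 2,
   the inner integrals being Mellin transforms of Gaussians.  With w = 2k + 1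
   and z = s + 2k, Gamma(z/2) is Gamma(s/2) times s(s+2)...(s+2k-2)/2^k, and the
   coefficients are those of the explicit Q_m.  The explicit Q_m has the
   defining property of Q_m because the coefficients of H_2m are explicit, and
   it is the only such polynomial because Gamma does not vanish at the positive
   integers. *)

(** * Integrals over the half-line *)

Section half_line.
Context {R : realType}.
Implicit Types (f g F : R -> R) (a b : R^nat).
Local Notation mu := (@lebesgue_measure R).

(** Complex integrals are pairs of total real integrals, so each identity travels with an
    integrability proof. On the half-line, the fundamental theorem and substitution are taken on
    compact intervals and passed to the limit, by monotone convergence and a splitting into positive
    and negative parts. The exchange of integrals needs a majorant. Since |t^(z-1)| = t^(Re z - 1),
    the kernel at the real point Re z serves, and its inner integral is given by the very formula
    proved for complex z. The result is multiplied by Gamma(w/2), and even the integrability of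
    t^(z-1) (1 + t^2)^(-w/2) is recovered by dividing by that factor. Hence the need for Gamma(k +
    1/2) to be nonzero; it comes from the closed value, which also produces the (2k)! in the
    denominators of Q_m. With z = s + 2k and w = 2k + 1, the difference w - z = 1 - s does not
    depend on k: this is why Gamma((1-s)/2) factors out of the sum and why one strip serves all
    k. *)

Lemma halfline_measurable f :
  (forall t : R, 0 < t -> {for t, continuous f}) ->
  measurable_fun (`]0, +oo[ : set R) f.
Proof.
move=> cf; apply: open_continuous_measurable_fun; first exact: interval_open.
by move=> t; rewrite inE/= in_itv/= andbT => /cf.
Qed.

Lemma bigcup_itvcc a b :
  (forall n, 0 < a n) -> a @ \oo --> 0 -> b @ \oo --> +oo ->
  \bigcup_n `[a n, b n]%classic = `]0, +oo[%classic :> set R.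
Proof.
move=> a0 acvg bcvg; apply/seteqP; split => [t [n _]|t]/=; rewrite !in_itv/=.
  by move=> /andP[/(lt_le_trans (a0 n)) ->].
rewrite andbT => t0.
near \oo => n; exists n => //=; rewrite in_itv/=; apply/andP; split.
  near: n; apply: (cvgr_le _ acvg) => //.
by near: n; move/cvgryPge : bcvg; apply.
Unshelve. all: by end_near. Qed.

Section exhaustion.
Variables a b : R^nat.
Hypotheses (a0 : forall n, 0 < a n) (acvg : a @ \oo --> 0).
Hypotheses (bcvg : b @ \oo --> +oo).
Hypotheses (dca : nonincreasing_seq a) (icb : nondecreasing_seq b).

Let nd_itvcc : nondecreasing_seq (fun n => `[a n, b n]%classic).
Proof.
move=> m n mn; rewrite subsetEset => t /=; rewrite !in_itv/= => /andP[h1 h2].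
by rewrite (le_trans (dca mn) h1) (le_trans h2 (icb mn)).
Qed.

Lemma itvcc_subset n : `[a n, b n]%classic `<=` (`]0, +oo[%classic : set R).
Proof.
by move=> t /=; rewrite !in_itv/= andbT => /andP[/(lt_le_trans (a0 n))].
Qed.

(** Monotone convergence along growing sets. The endpoints stay general because the substitution t
    -> c t^2 replaces [lo n] and [hi n] by [c * lo n ^+ 2] and [c * hi n ^+ 2]. *)
Lemma ge0_cvg_integral_halfline (f : R -> \bar R) :
  measurable_fun (`]0, +oo[ : set R) f -> (forall t : R, 0 < t -> (0 <= f t)%E) ->
  (\int[mu]_(t in `[a n, b n]) f t)%E @[n --> \oo] -->
  (\int[mu]_(t in `]0%R, +oo[) f t)%E.
Proof.
move=> mf f0; rewrite -(bigcup_itvcc a0 acvg bcvg).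
apply: ge0_nondecreasing_set_cvg_integral => //.
- by move=> n; apply: measurable_funS mf => //; exact: itvcc_subset.
- by move=> n t /itvcc_subset/=; rewrite in_itv/= andbT => /f0.
Qed.

Lemma cvg_integral_halfline (f : R -> \bar R) :
  mu.-integrable `]0, +oo[ f ->
  (\int[mu]_(t in `[a n, b n]) f t)%E @[n --> \oo] -->
  (\int[mu]_(t in `]0%R, +oo[) f t)%E.
Proof.
move=> intf; rewrite integralE.
under eq_fun do rewrite integralE.
have mf := measurable_int _ intf.
apply: cvgeB.
(* Integrability excludes oo - oo in the difference of the two limits. *)
- exact: integrable_add_def.
- by apply: ge0_cvg_integral_halfline => //; exact: measurable_funepos.
- by apply: ge0_cvg_integral_halfline => //; exact: measurable_funeneg.
Qed.

End exhaustion.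

Definition lo n : R := n.+1%:R^-1.
Definition hi n : R := n.+1%:R.

Lemma lo_gt0 n : 0 < lo n. Proof. by rewrite invr_gt0. Qed.

Lemma lo_le_hi n : lo n <= hi n.
Proof.
by apply: (@le_trans _ _ 1); [rewrite invf_le1 ?ler1n|rewrite ler1n].
Qed.

Lemma cvg_lo : lo @ \oo --> 0.
Proof. exact: cvg_harmonic. Qed.

Lemma cvg_hi : hi @ \oo --> +oo.
Proof.
have -> : hi = [sequence n%:R + 1]_n by apply/funext => n; rewrite /hi/= natr1.
by apply/cvgryPge => r; near=> n; rewrite -lerBlDr; near: n; exact: nbhs_infty_ger.
Unshelve. all: by end_near. Qed.

Lemma lo_nonincreasing : nonincreasing_seq lo.
Proof. by move=> m n mn; rewrite lef_pV2 ?posrE// ler_nat. Qed.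

Lemma hi_nondecreasing : nondecreasing_seq hi.
Proof. by move=> m n mn; rewrite ler_nat. Qed.

Lemma continuous_FTC2_cc f F x y : 0 < x -> x <= y ->
  (forall t : R, 0 < t -> is_derive t 1 F (f t)) ->
  (forall t : R, 0 < t -> {for t, continuous f}) ->
  (\int[mu]_(t in `[x, y]) (f t)%:E = (F y)%:E - (F x)%:E)%E.
Proof.
move=> x0; rewrite le_eqVlt => /predU1P[<- _ _|xy dF cf].
  (* The degenerate interval does occur: [lo 0] and [hi 0] are both 1. *)
  by rewrite set_itv1 integral_set1 -EFinB subrr.
have cF t : 0 < t -> {for t, continuous F}.
  by move=> /dF dFt; apply/differentiable_continuous/derivable1_diffP.
apply: continuous_FTC2 => //.
- apply: continuous_in_subspaceT => t; rewrite inE/= in_itv/= => /andP[xt _].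
  exact/cf/(lt_le_trans x0).
- split.
  + by move=> t; rewrite in_itv/= => /andP[xt _]; have := dF t (lt_trans x0 xt).
  + exact/cvg_at_right_filter/cF.
  + by apply/cvg_at_left_filter/cF; exact: lt_trans xy.
- move=> t; rewrite in_itv/= => /andP[xt _].
  by rewrite derive1E; have := dF t (lt_trans x0 xt) => dFt; exact: derive_val.
Qed.

Lemma continuous_FTC2_halfline f F l0 l1 :
  (forall t : R, 0 < t -> is_derive t 1 F (f t)) ->
  (forall t : R, 0 < t -> {for t, continuous f}) ->
  mu.-integrable `]0, +oo[ (EFin \o f) ->
  F \o lo @ \oo --> l0 -> F \o hi @ \oo --> l1 ->
  \int[mu]_(t in `]0, +oo[) f t = l1 - l0.
Proof.
move=> dF cf intf Fl0 Fl1; rewrite /Rintegral.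
have /cvg_lim <- // := cvg_integral_halfline lo_gt0 cvg_lo cvg_hi
  lo_nonincreasing hi_nondecreasing intf.
suff /cvg_lim -> : (\int[mu]_(t in `[lo n, hi n]) (EFin \o f) t)%E @[n --> \oo]
    --> (l1 - l0)%:E by [].
under eq_fun => n do rewrite (continuous_FTC2_cc (lo_gt0 n) (lo_le_hi n) dF cf) -EFinB.
by apply: cvg_EFin; [exact: nearW|exact: cvgB].
Qed.

(** The integrals over [[lo n, hi n]] equal F(hi n) - F(lo n), hence stay below 2M, and so does
    their limit. *)
Lemma ge0_integrable_halfline f F (M : R) :
  (forall t : R, 0 < t -> is_derive t 1 F (f t)) ->
  (forall t : R, 0 < t -> {for t, continuous f}) ->
  (forall t : R, 0 < t -> 0 <= f t) -> (forall t : R, 0 < t -> `|F t| <= M) ->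
  mu.-integrable `]0, +oo[ (EFin \o f).
Proof.
move=> dF cf f0 FM.
have mf : measurable_fun (`]0, +oo[ : set R) (EFin \o f).
  by apply/measurable_EFinP; exact: halfline_measurable cf.
apply/integrableP; split => //.
under eq_integral => t.
  rewrite inE/= in_itv/= andbT => /f0 ft; rewrite /= ger0_norm//; over.
have f0E t : 0 < t -> (0 <= (EFin \o f) t)%E by move=> /f0; rewrite lee_fin.
have := ge0_cvg_integral_halfline lo_gt0 cvg_lo cvg_hi
  lo_nonincreasing hi_nondecreasing mf f0E.
under eq_fun => n do rewrite (continuous_FTC2_cc (lo_gt0 n) (lo_le_hi n) dF cf) -EFinB.
move=> cv; apply: (@le_lt_trans _ _ (M + M)%:E); last by rewrite ltry.
have /cvg_lim <- // := cv.
apply: lime_le; first by apply/cvg_ex; eexists; exact: cv.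
apply: nearW => n; rewrite lee_fin.
have hi0 : 0 < hi n by rewrite ltr0n.
rewrite (le_trans (ler_norm _))// (le_trans (ler_normB _ _))// lerD// FM//.
exact: lo_gt0.
Qed.

(** * The substitution u = c t^2 on the half-line *)

Lemma sqr_substitution_cc g (c x y : R) : 0 < c -> 0 < x -> x <= y ->
  (forall t : R, 0 < t -> {for t, continuous g}) ->
  (\int[mu]_(t in `[(c * x ^+ 2)%R, (c * y ^+ 2)%R]) (g t)%:E =
   \int[mu]_(t in `[x, y]) (g (c * t ^+ 2) * (2 * c * t))%:E)%E.
Proof.
move=> c0 x0 xy cg; pose F t : R := c * t ^+ 2.
have dF (t : R) : is_derive t 1 F (2 * c * t).
  rewrite /F; apply: is_derive_eq.
  by rewrite /GRing.scale/=; ring.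
have F'E : derive1 F = (fun t => 2 * c * t).
  by apply/funext => t; rewrite derive1E; exact: derive_val.
have cF : continuous F.
  by move=> t; apply/differentiable_continuous/derivable1_diffP; have := dF t.
have cF' : continuous (derive1 F).
  by rewrite F'E => t; apply: cvgM; [exact: cvg_cst|exact: cvg_id].
rewrite (@integration_by_substitution_increasing _ F)//.
- by apply: eq_integral => t _; rewrite fctE /= F'E.
- move=> s t; rewrite !in_itv/= => /andP[xs _] /andP[xt _] st.
  by rewrite /F ltr_pM2l// ltr_pXn2r// nnegrE (le_trans (ltW x0)).
- by apply/cvg_ex; exists (derive1 F x); exact/cvg_at_right_filter/cF'.
- by apply/cvg_ex; exists (derive1 F y); exact/cvg_at_left_filter/cF'.
- split.
  + by move=> t _; have := dF t.
  + exact/cvg_at_right_filter/cF.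
  + exact/cvg_at_left_filter/cF.
- apply: continuous_in_subspaceT => t; rewrite inE/= in_itv/= => /andP[xt _].
  by apply/cg/(lt_le_trans _ xt); rewrite mulr_gt0// exprn_gt0.
Qed.

Section sqr_substitution.
Variable c : R.
Hypothesis c0 : 0 < c.

Lemma continuous_sqr_substitution g :
  (forall t : R, 0 < t -> {for t, continuous g}) -> forall t : R, 0 < t ->
  {for t, continuous (fun t : R => g (c * t ^+ 2) * (2 * c * t))}.
Proof.
move=> cg t t0; rewrite /prop_for /continuous_at.
have cc : {for t, continuous (fun t : R => c * t ^+ 2)}.
  by apply: cvgM; [exact: cvg_cst|exact: exprn_continuous].
apply: cvgM; last by apply: cvgM; [exact: cvg_cst|exact: cvg_id].
apply: (continuous_comp cc); apply: cg.
by rewrite mulr_gt0// exprn_gt0.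
Qed.

Lemma cvg_sqr_lo : (fun n => c * lo n ^+ 2) @ \oo --> 0.
Proof.
rewrite -(mulr0 c); apply: cvgM; first exact: cvg_cst.
by rewrite -(mulr0 0); under eq_fun do rewrite expr2; apply: cvgM; exact: cvg_lo.
Qed.

Lemma cvg_sqr_hi : (fun n => c * hi n ^+ 2) @ \oo --> +oo.
Proof.
apply/cvgryPge => r; near=> n.
have : r / c <= hi n by near: n; move/cvgryPge : cvg_hi; apply.
rewrite ler_pdivrMr// mulrC => /le_trans; apply.
by rewrite ler_pM2l// ler_eXnr// ler1n.
Unshelve. all: by end_near. Qed.

Let lo2_gt0 n : 0 < c * lo n ^+ 2.
Proof. by rewrite mulr_gt0// exprn_gt0// lo_gt0. Qed.

Let lo2_nonincreasing : nonincreasing_seq (fun n => c * lo n ^+ 2).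
Proof.
by move=> m n mn; rewrite ler_pM2l// lerXn2r ?nnegrE ?(ltW (lo_gt0 _))// lo_nonincreasing.
Qed.

Let hi2_nondecreasing : nondecreasing_seq (fun n => c * hi n ^+ 2).
Proof.
by move=> m n mn; rewrite ler_pM2l// lerXn2r ?nnegrE ?ler0n// hi_nondecreasing.
Qed.

(** Both sides are limits of one sequence of integrals, read along two exhaustions of the half-line
    that correspond under t -> c t^2. The equality is in the extended reals so that it can decide
    integrability. *)
Lemma ge0_sqr_substitution g : (forall t : R, 0 < t -> {for t, continuous g}) ->
  (forall t : R, 0 < t -> 0 <= g t) ->
  (\int[mu]_(t in `]0%R, +oo[) (g t)%:E =
   \int[mu]_(t in `]0%R, +oo[) (g (c * t ^+ 2) * (2 * c * t))%:E)%E.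
Proof.
move=> cg g0; pose h t := g (c * t ^+ 2) * (2 * c * t).
have mg := halfline_measurable cg.
have mh := halfline_measurable (continuous_sqr_substitution cg).
have h0 t : 0 < t -> (0 <= (EFin \o h) t)%E.
  move=> t0; rewrite lee_fin mulr_ge0 ?g0 ?mulr_ge0// ?ltW//.
  by rewrite mulr_gt0// exprn_gt0.
have g0E t : 0 < t -> (0 <= (EFin \o g) t)%E by move=> /g0; rewrite lee_fin.
have cvg1 := ge0_cvg_integral_halfline lo2_gt0 cvg_sqr_lo cvg_sqr_hi
  lo2_nonincreasing hi2_nondecreasing ((measurable_EFinP _ _).2 mg) g0E.
have cvg2 := ge0_cvg_integral_halfline lo_gt0 cvg_lo cvg_hi
  lo_nonincreasing hi_nondecreasing ((measurable_EFinP _ _).2 mh) h0.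
move: cvg1 => /=.
under eq_fun => n do rewrite (sqr_substitution_cc c0 (lo_gt0 n) (lo_le_hi n) cg).
by move=> /cvg_lim <- //; exact: cvg_lim cvg2.
Qed.

(** The nonnegative formula applied to |g| transfers finiteness, the factor [2 * c * t] being
    positive. *)
Lemma integrable_sqr_substitution g :
  (forall t : R, 0 < t -> {for t, continuous g}) ->
  mu.-integrable `]0, +oo[ (EFin \o g) ->
  mu.-integrable `]0, +oo[ (EFin \o (fun t => g (c * t ^+ 2) * (2 * c * t))).
Proof.
move=> cg /integrableP[_ gfin]; apply/integrableP; split.
  by apply/measurable_EFinP; exact: halfline_measurable (continuous_sqr_substitution cg).
move: gfin; congr (_ < _)%E.
have cng (t : R) : 0 < t -> {for t, continuous (fun t : R => `|g t|)}.
  by move=> t0; apply: cvg_norm; exact: cg.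
rewrite (ge0_sqr_substitution cng) //.
apply: eq_integral => t; rewrite inE/= in_itv/= andbT => t0.
by rewrite normrM (ger0_norm (_ : 0 <= 2 * c * t))// ltW// !mulr_gt0.
Qed.

Lemma sqr_substitution g :
  (forall t : R, 0 < t -> {for t, continuous g}) ->
  mu.-integrable `]0, +oo[ (EFin \o g) ->
  \int[mu]_(t in `]0, +oo[) g t =
  \int[mu]_(t in `]0, +oo[) (g (c * t ^+ 2) * (2 * c * t)).
Proof.
move=> cg intg; have inth := integrable_sqr_substitution cg intg.
have := cvg_integral_halfline lo2_gt0 cvg_sqr_lo cvg_sqr_hi
  lo2_nonincreasing hi2_nondecreasing intg.
have cvg2 := cvg_integral_halfline lo_gt0 cvg_lo cvg_hi
  lo_nonincreasing hi_nondecreasing inth.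
under eq_fun => n do rewrite (sqr_substitution_cc c0 (lo_gt0 n) (lo_le_hi n) cg).
by move=> /cvg_lim; rewrite /Rintegral => <- //; rewrite (cvg_lim _ cvg2).
Qed.

End sqr_substitution.
End half_line.

(** * Complex powers *)

Section complex_power.
Context {R : realType}.
Implicit Types (s z w : R[i]) (t x y : R) (n : nat).

Lemma ReD z w : complex.Re (z + w) = complex.Re z + complex.Re w.
Proof. by case: z w => [a b] [c d]. Qed.

Lemma ImD z w : complex.Im (z + w) = complex.Im z + complex.Im w.
Proof. by case: z w => [a b] [c d]. Qed.

Lemma ReN z : complex.Re (- z) = - complex.Re z.
Proof. by case: z. Qed.

Lemma ImN z : complex.Im (- z) = - complex.Im z.
Proof. by case: z. Qed.

Lemma ReM z w : complex.Re (z * w) =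
  complex.Re z * complex.Re w - complex.Im z * complex.Im w.
Proof. by case: z w => [a b] [c d]. Qed.

Lemma ImM z w : complex.Im (z * w) =
  complex.Re z * complex.Im w + complex.Im z * complex.Re w.
Proof. by case: z w => [a b] [c d]. Qed.

Lemma natc n : n%:R = (n%:R)%:C :> R[i].
Proof. by rewrite rmorph_nat. Qed.

Lemma Re_nat n : complex.Re (n%:R : R[i]) = n%:R.
Proof. by rewrite natc. Qed.

Lemma half_complex z : z / 2 = (complex.Re z / 2) +i* (complex.Im z / 2).
Proof.
have -> : (2 : R[i])^-1 = (2^-1)%:C by rewrite fmorphV rmorph_nat.
by case: z => a b; simpc.
Qed.

Lemma Re_half z : complex.Re (z / 2) = complex.Re z / 2.
Proof. by rewrite half_complex. Qed.

Lemma cpowE t s : cpow t s =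
  (expR (complex.Re s * ln t) * cos (complex.Im s * ln t)) +i*
  (expR (complex.Re s * ln t) * sin (complex.Im s * ln t)).
Proof. by rewrite /cpow; simpc. Qed.

Lemma Re_cpow t s :
  complex.Re (cpow t s) = expR (complex.Re s * ln t) * cos (complex.Im s * ln t).
Proof. by rewrite cpowE. Qed.

Lemma Im_cpow t s :
  complex.Im (cpow t s) = expR (complex.Re s * ln t) * sin (complex.Im s * ln t).
Proof. by rewrite cpowE. Qed.

Lemma cpowD t s z : cpow t (s + z) = cpow t s * cpow t z.
Proof.
rewrite !cpowE ReD ImD !mulrDl expRD cosD sinD; simpc.
by congr (_ +i* _); ring.
Qed.

Lemma cpow_real t x : cpow t x%:C = (expR (x * ln t))%:C.
Proof. by rewrite /cpow /= mul0r cos0 sin0; simpc. Qed.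

Lemma cpow0 t : cpow t 0 = 1.
Proof. by rewrite (cpow_real t 0) mul0r expR0. Qed.

Lemma cpow_nat t n : 0 < t -> cpow t n%:R = (t ^+ n)%:C.
Proof.
by move=> t0; rewrite natc cpow_real expRM_natl lnK// posrE.
Qed.

Lemma cpow1 t : 0 < t -> cpow t 1 = t%:C.
Proof. by move=> /(cpow_nat 1); rewrite expr1. Qed.

Lemma cpowMl x y s : 0 < x -> 0 < y -> cpow (x * y) s = cpow x s * cpow y s.
Proof.
move=> x0 y0; rewrite !cpowE lnM ?posrE// !mulrDr expRD cosD sinD; simpc.
by congr (_ +i* _); ring.
Qed.

Lemma cpow_sqr t s : 0 < t -> cpow (t ^+ 2) s = cpow t (2 * s).
Proof.
by move=> t0; rewrite expr2 cpowMl// -cpowD; congr cpow; ring.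
Qed.

Lemma cpowN t s : cpow t (- s) * cpow t s = 1.
Proof. by rewrite -cpowD addNr cpow0. Qed.

Lemma cpow_neq0 t s : cpow t s != 0.
Proof.
by apply/eqP => c0; move: (cpowN t s); rewrite c0 mulr0 => /esym/eqP; rewrite oner_eq0.
Qed.

(** The right-hand side is the modulus of t^s; every domination argument below goes through it. *)
Lemma Re_cpow_le t s : `|complex.Re (cpow t s)| <= expR (complex.Re s * ln t).
Proof.
by rewrite Re_cpow normrM ger0_norm ?expR_ge0// ler_piMr ?expR_ge0// cos_max.
Qed.

Lemma Im_cpow_le t s : `|complex.Im (cpow t s)| <= expR (complex.Re s * ln t).
Proof.
by rewrite Im_cpow normrM ger0_norm ?expR_ge0// ler_piMr ?expR_ge0// sin_max.
Qed.

(** The whole line is wanted, [ln] being total, because the exchange of integrals takes place on the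
    full product space. *)
Lemma measurable_Re_cpow s : measurable_fun setT (fun t => complex.Re (cpow t s)).
Proof.
under eq_fun do rewrite Re_cpow.
apply: measurable_funM; apply: measurableT_comp => //.
- by apply: measurable_funM => //; exact: measurable_ln.
- by apply: continuous_measurable_fun => x; exact: continuous_cos.
- by apply: measurable_funM => //; exact: measurable_ln.
Qed.

Lemma measurable_Im_cpow s : measurable_fun setT (fun t => complex.Im (cpow t s)).
Proof.
under eq_fun do rewrite Im_cpow.
apply: measurable_funM; apply: measurableT_comp => //.
- by apply: measurable_funM => //; exact: measurable_ln.
- by apply: continuous_measurable_fun => x; exact: continuous_sin.
- by apply: measurable_funM => //; exact: measurable_ln.
Qed.

Lemma cpowB1 t s : 0 < t -> cpow t (s - 1) = t^-1%:C * cpow t s.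
Proof.
move=> t0; rewrite -[in RHS](subrK 1 s) [in RHS]cpowD cpow1//.
by rewrite mulrCA -rmorphM/= mulVf ?mulr1// gt_eqF.
Qed.

Lemma is_derive_Re_cpow t s : 0 < t ->
  is_derive t 1 (fun t => complex.Re (cpow t s)) (complex.Re (s * cpow t (s - 1))).
Proof.
move=> t0; have dln := is_derive1_ln t0.
under eq_fun do rewrite Re_cpow.
apply: is_derive_eq; rewrite cpowB1// cpowE; case: s => a b; simpc => /=; rewrite /GRing.scale/=.
by ring.
Qed.

Lemma is_derive_Im_cpow t s : 0 < t ->
  is_derive t 1 (fun t => complex.Im (cpow t s)) (complex.Im (s * cpow t (s - 1))).
Proof.
move=> t0; have dln := is_derive1_ln t0.
under eq_fun do rewrite Im_cpow.
apply: is_derive_eq; rewrite cpowB1// cpowE; case: s => a b; simpc => /=; rewrite /GRing.scale/=.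
by ring.
Qed.

Lemma continuous_Re_cpow t s : 0 < t ->
  {for t, continuous (fun t => complex.Re (cpow t s))}.
Proof.
by move=> /(is_derive_Re_cpow s) [? _]; apply/differentiable_continuous/derivable1_diffP.
Qed.

Lemma continuous_Im_cpow t s : 0 < t ->
  {for t, continuous (fun t => complex.Im (cpow t s))}.
Proof.
by move=> /(is_derive_Im_cpow s) [? _]; apply/differentiable_continuous/derivable1_diffP.
Qed.

End complex_power.

(** * Complex integrals and Mellin transforms *)

Section complex_integral.
Context {R : realType}.
Implicit Types (F G : R -> R[i]) (f g : R -> R) (s z c : R[i]) (t : R).
Local Notation mu := (@lebesgue_measure R).

Lemma eq_cintegrable F G : (forall t, 0 < t -> F t = G t) ->
  cintegrable F -> cintegrable G.
Proof.
move=> FG [ReF ImF]; split.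
- apply: eq_integrable ReF => // t; rewrite inE/= in_itv/= andbT => t0.
  by rewrite FG.
- apply: eq_integrable ImF => // t; rewrite inE/= in_itv/= andbT => t0.
  by rewrite FG.
Qed.

Lemma eq_cintegral F G : (forall t, 0 < t -> F t = G t) ->
  cintegral F = cintegral G.
Proof.
move=> FG; rewrite /cintegral; congr (_ +i* _); apply: eq_Rintegral => t;
  by rewrite inE/= in_itv/= andbT => t0; rewrite FG.
Qed.

Lemma cintegrableD F G : cintegrable F -> cintegrable G ->
  cintegrable (fun t => F t + G t).
Proof.
move=> [ReF ImF] [ReG ImG]; split.
- by apply: eq_integrable (integrableD _ ReF ReG) => // t _; rewrite ReD.
- by apply: eq_integrable (integrableD _ ImF ImG) => // t _; rewrite ImD.
Qed.

Lemma cintegralD F G : cintegrable F -> cintegrable G ->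
  cintegral (fun t => F t + G t) = cintegral F + cintegral G.
Proof.
move=> [ReF ImF] [ReG ImG]; rewrite /cintegral; simpc; congr (_ +i* _).
- by under eq_Rintegral do rewrite /= ReD; rewrite RintegralD.
- by under eq_Rintegral do rewrite /= ImD; rewrite RintegralD.
Qed.

Lemma cintegrableZ c F : cintegrable F -> cintegrable (fun t => c * F t).
Proof.
move=> [ReF ImF]; split.
- apply: (@eq_integrable _ _ _ mu _ _ (fun t => (complex.Re c)%:E *
      (complex.Re (F t))%:E - (complex.Im c)%:E * (complex.Im (F t))%:E)%E) => //.
    by move=> t _; rewrite ReM.
  by apply: integrableB => //; exact: integrableZl.
- apply: (@eq_integrable _ _ _ mu _ _ (fun t => (complex.Re c)%:E *
      (complex.Im (F t))%:E + (complex.Im c)%:E * (complex.Re (F t))%:E)%E) => //.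
    by move=> t _; rewrite ImM.
  by apply: integrableD => //; exact: integrableZl.
Qed.

Lemma cintegralZ c F : cintegrable F ->
  cintegral (fun t => c * F t) = c * cintegral F.
Proof.
move=> [ReF ImF]; have Zl (a : R) f : mu.-integrable `]0, +oo[ (EFin \o f) ->
    mu.-integrable `]0, +oo[ (EFin \o (fun t => a * f t)).
  by move=> intf; apply: eq_integrable (integrableZl _ a intf).
rewrite /cintegral; case: c => a b; simpc; congr (_ +i* _).
- under eq_Rintegral do rewrite ReM/=.
  by rewrite RintegralB ?RintegralZl//; exact: Zl.
- under eq_Rintegral do rewrite ImM/=.
  by rewrite RintegralD ?RintegralZl//; exact: Zl.
Qed.

Lemma cintegral0 : cintegral (fun=> 0 : R[i]) = 0 :> R[i].
Proof. by rewrite /cintegral /Rintegral !integral0. Qed.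

Lemma cintegrable0 : cintegrable (fun=> 0 : R[i]).
Proof. by split; exact: integrable0. Qed.

Lemma cintegrable_sum n (F : nat -> R -> R[i]) :
  (forall k, (k < n)%N -> cintegrable (F k)) ->
  cintegrable (fun t => \sum_(k < n) F k t).
Proof.
elim: n => [|n IH] intF; first by apply: eq_cintegrable cintegrable0 => t _; rewrite big_ord0.
apply: (@eq_cintegrable (fun t => \sum_(k < n) F k t + F n t)).
  by move=> t _; rewrite big_ord_recr.
apply: cintegrableD; last exact: intF.
by apply: IH => k kn; apply: intF; exact: ltnW.
Qed.

Lemma cintegral_sum n (F : nat -> R -> R[i]) :
  (forall k, (k < n)%N -> cintegrable (F k)) ->
  cintegral (fun t => \sum_(k < n) F k t) = \sum_(k < n) cintegral (F k).
Proof.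
elim: n => [|n IH] intF.
  rewrite big_ord0 -[RHS]cintegral0.
  by apply: eq_cintegral => t _; rewrite big_ord0.
rewrite (@eq_cintegral _ (fun t => \sum_(k < n) F k t + F n t)); last first.
  by move=> t _; rewrite big_ord_recr.
have intF' k : (k < n)%N -> cintegrable (F k) by move=> kn; apply: intF; exact: ltnW.
by rewrite cintegralD ?IH ?big_ord_recr//; [exact: cintegrable_sum|exact: intF].
Qed.

Lemma le_cintegrable F g :
  measurable_fun (`]0, +oo[ : set R) (fun t => complex.Re (F t)) ->
  measurable_fun (`]0, +oo[ : set R) (fun t => complex.Im (F t)) ->
  (forall t, 0 < t -> `|complex.Re (F t)| <= g t) ->
  (forall t, 0 < t -> `|complex.Im (F t)| <= g t) ->
  mu.-integrable `]0, +oo[ (EFin \o g) -> cintegrable F.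
Proof.
move=> mRe mIm leRe leIm intg; split.
- apply: le_integrable intg => //; first exact/measurable_EFinP.
  move=> t /=; rewrite in_itv/= andbT => t0; rewrite lee_fin.
  by rewrite (le_trans (leRe _ t0))// ler_norm.
- apply: le_integrable intg => //; first exact/measurable_EFinP.
  move=> t /=; rewrite in_itv/= andbT => t0; rewrite lee_fin.
  by rewrite (le_trans (leIm _ t0))// ler_norm.
Qed.

Lemma Re_mellin_integrand f s t :
  complex.Re (mellin_integrand f s t) = complex.Re (cpow t (s - 1)) * f t.
Proof. by rewrite /mellin_integrand ReM /= mulr0 subr0. Qed.

Lemma Im_mellin_integrand f s t :
  complex.Im (mellin_integrand f s t) = complex.Im (cpow t (s - 1)) * f t.
Proof. by rewrite /mellin_integrand ImM /= mulr0 add0r. Qed.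

Lemma measurable_Re_mellin_integrand f s : measurable_fun (`]0, +oo[ : set R) f ->
  measurable_fun (`]0, +oo[ : set R) (fun t => complex.Re (mellin_integrand f s t)).
Proof.
move=> mf.
rewrite (_ : (fun t => _) = (fun t => complex.Re (cpow t (s - 1)) * f t)); last first.
  by apply/funext => t; exact: Re_mellin_integrand.
apply: measurable_funM => //; apply: measurable_funTS; exact: measurable_Re_cpow.
Qed.

Lemma measurable_Im_mellin_integrand f s : measurable_fun (`]0, +oo[ : set R) f ->
  measurable_fun (`]0, +oo[ : set R) (fun t => complex.Im (mellin_integrand f s t)).
Proof.
move=> mf.
rewrite (_ : (fun t => _) = (fun t => complex.Im (cpow t (s - 1)) * f t)); last first.
  by apply/funext => t; exact: Im_mellin_integrand.
apply: measurable_funM => //; apply: measurable_funTS; exact: measurable_Im_cpow.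
Qed.

(* The derivative of [- (a (1 + t^a))^-1], which is bounded. *)
Lemma integrable_power_kernel (a : R) : 0 < a ->
  mu.-integrable `]0, +oo[
    (EFin \o (fun t => expR (a * ln t) / t / (1 + expR (a * ln t)) ^+ 2)).
Proof.
move=> a0; pose p t := expR (a * ln t).
have p1 t : 0 < 1 + p t by rewrite addr_gt0// expR_gt0.
have dp t : 0 < t -> is_derive t 1 p (a * (p t / t)).
  move=> t0; have dln := is_derive1_ln t0; rewrite /p.
  by apply: is_derive_eq; rewrite /GRing.scale/=; ring.
have cp t : 0 < t -> {for t, continuous p}.
  by move=> /dp[? _]; apply/differentiable_continuous/derivable1_diffP.
apply: (@ge0_integrable_halfline _ _ (fun t => - (a^-1 * (1 + p t)^-1)) a^-1).
- move=> t t0; have dpt := dp t t0.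
  have p1n : 1 + p t != 0 by rewrite gt_eqF.
  have dV : is_derive t 1 (fun t => (1 + p t)^-1) (- (1 + p t) ^- 2 * (a * (p t / t))).
    have d1p : is_derive t 1 (fun t => 1 + p t) (a * (p t / t)).
      by have := is_deriveD (is_derive_cst (1 : R) t 1) dpt; rewrite add0r.
    split; first exact: derivableV.
    by rewrite deriveV// derive_val.
  apply: is_derive_eq; rewrite /GRing.scale/=.
  by rewrite -/(p t); field; rewrite p1n !gt_eqF.
- move=> t t0; rewrite /prop_for /continuous_at -/(p t).
  apply: cvgM.
    apply: cvgM; first exact: cp.
    by apply: cvgV; [rewrite gt_eqF|exact: cvg_id].
  apply: cvgV; first by rewrite gt_eqF// exprn_gt0.
  rewrite expr2; under eq_fun do rewrite expr2.
  by apply: cvgM; (apply: cvgD; [exact: cvg_cst|exact: cp]).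
- move=> t t0; rewrite -/(p t); apply: divr_ge0; last exact/ltW/exprn_gt0.
  by rewrite divr_ge0 ?expR_ge0// ltW.
- move=> t t0; rewrite normrN normrM !ger0_norm ?invr_ge0 ?(ltW a0) ?(ltW (p1 t))//.
  by rewrite ler_piMr ?invr_ge0 ?(ltW a0)// invf_le1// lerDl expR_ge0.
Qed.

(** With a = Re s, the majorant t^(a-1) / (1 + t^a)^2 behaves like t^(a-1) at 0 and like t^(-a-1) at
    infinity, so a single bound on f controls both ends. *)
Lemma mellin_integrable_bounded f s (C : R) : 0 < complex.Re s ->
  measurable_fun (`]0, +oo[ : set R) f ->
  (forall t, 0 < t -> `|f t| * (1 + expR (complex.Re s * ln t)) ^+ 2 <= C) ->
  mellin_integrable f s.
Proof.
move=> s0 mf fC; set a := complex.Re s in fC *; pose p t := expR (a * ln t).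
pose g t := C * (p t / t / (1 + p t) ^+ 2).
have le_g t : 0 < t -> expR ((a - 1) * ln t) * `|f t| <= g t.
  move=> t0; rewrite mulrBl mul1r expRB lnK ?posrE// /g -/(p t).
  rewrite mulrCA ler_wpM2l//; first by rewrite divr_ge0 ?expR_ge0// ltW.
  by rewrite ler_pdivlMr ?fC// exprn_gt0// addr_gt0// expR_gt0.
have Re1 : complex.Re (s - 1) = a - 1 by rewrite ReD ReN.
apply: (@le_cintegrable _ g).
- exact: measurable_Re_mellin_integrand.
- exact: measurable_Im_mellin_integrand.
- move=> t t0; rewrite Re_mellin_integrand normrM (le_trans _ (le_g _ t0))//.
  by rewrite ler_wpM2r// -Re1 Re_cpow_le.
- move=> t t0; rewrite Im_mellin_integrand normrM (le_trans _ (le_g _ t0))//.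
  by rewrite ler_wpM2r// -Re1 Im_cpow_le.
- by apply: eq_integrable (integrableZl _ C (integrable_power_kernel s0)).
Qed.

End complex_integral.

(** * The Gamma function *)

Section gamma.
Context {R : realType}.
Implicit Types (f : R -> R) (s z : R[i]) (a t : R).
Local Notation mu := (@lebesgue_measure R).

(** This is ln x <= x at x = t / a; exponentiated, it reads t^a <= a^a e^t, the comparison of powers
    with the exponential. *)
Lemma ln_le_linear a t : 0 < a -> 0 < t -> a * ln t <= t + a * ln a.
Proof.
move=> a0 t0; have ta0 : 0 < t / a by rewrite divr_gt0.
have -> : ln t = ln (t / a) + ln a by rewrite -lnM ?posrE// divfK// gt_eqF.
rewrite mulrDr lerD2r -[leRHS](divfK (lt0r_neq0 a0)) mulrC ler_pM2r//.
exact/ltW/ln_sublinear.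
Qed.

Lemma expN_power_le a t : 0 < a -> 0 < t ->
  expR (- t) * (1 + expR (a * ln t)) ^+ 2 <= 2 + 2 * expR (2 * a * ln (2 * a)).
Proof.
move=> a0 t0; set p := expR (a * ln t).
have p2 : p ^+ 2 = expR (2 * a * ln t) by rewrite -expRM_natl mulrA.
have : expR (- t) * p ^+ 2 <= expR (2 * a * ln (2 * a)).
  by rewrite p2 -expRD ler_expR addrC lerBlDr addrC ln_le_linear// mulr_gt0.
have e1 : expR (- t) <= 1 by rewrite expR_le1 oppr_le0 ltW.
(* Nonnegativity of (1 - p)^2 is the inequality (1 + p)^2 <= 2 + 2 p^2; multiplied by e^(-t), its
   two terms are bounded by [e1] and by the comparison at exponent 2a. *)
have := expR_ge0 (- t); have : 0 <= (1 - p) ^+ 2 := sqr_ge0 _.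
nra.
Qed.

Lemma continuous_expRN t : {for t, continuous (fun t : R => expR (- t))}.
Proof. by apply: continuous_comp; [exact: opp_continuous|exact: continuous_expR]. Qed.

Lemma Gamma_integrable z : 0 < complex.Re z ->
  mellin_integrable (fun t : R => expR (- t)) z.
Proof.
move=> z0; apply: (mellin_integrable_bounded z0).
  by apply: halfline_measurable => t _; exact: continuous_expRN.
by move=> t t0; rewrite ger0_norm ?expR_ge0//; exact: expN_power_le.
Qed.

Lemma continuous_Re_mellin_integrand f s t : 0 < t -> {for t, continuous f} ->
  {for t, continuous (fun t => complex.Re (mellin_integrand f s t))}.
Proof.
move=> t0 cf; rewrite /prop_for /continuous_at Re_mellin_integrand.
under eq_fun do rewrite Re_mellin_integrand.
by apply: cvgM => //; exact: continuous_Re_cpow.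
Qed.

Lemma continuous_Im_mellin_integrand f s t : 0 < t -> {for t, continuous f} ->
  {for t, continuous (fun t => complex.Im (mellin_integrand f s t))}.
Proof.
move=> t0 cf; rewrite /prop_for /continuous_at Im_mellin_integrand.
under eq_fun do rewrite Im_mellin_integrand.
by apply: cvgM => //; exact: continuous_Im_cpow.
Qed.

Lemma cvg_ln_hi : (fun n => ln (hi n : R)) @ \oo --> +oo.
Proof.
have /cvgryPge hioo := @cvg_hi R.
apply/cvgryPge => r; near=> n.
rewrite -[leLHS]expRK ler_ln ?posrE ?expR_gt0// ?ltr0n//.
by near: n; exact: hioo.
Unshelve. all: by end_near. Qed.

Lemma cvg_expN_scale (u : R^nat) a : 0 < a -> u @ \oo --> +oo ->
  (fun n => expR (- (a * u n))) @ \oo --> 0.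
Proof.
move=> a0 uoo.
have auoo : (fun n => a * u n) @ \oo --> +oo.
  move: uoo => /cvgryPge uoo; apply/cvgryPge => r.
  by apply: filterS (uoo (r / a)) => n; rewrite ler_pdivrMr// mulrC.
exact: (@cvg_comp _ _ _ (fun n => a * u n) (fun x : R => expR (- x)) _ _ _ auoo (@cvgr_expR R)).
Qed.

Lemma cvg_power_exp_lo a : 0 < a ->
  (fun t => expR (a * ln t) * expR (- t)) \o lo @ \oo --> 0.
Proof.
(* As [lo n] is the inverse of [hi n], the power at [lo n] is exp(- a ln(hi n)); the other factor is
   at most 1. *)
move=> a0; apply: (@squeeze_cvgr _ _ _ _ (cst 0) (fun n => expR (- (a * ln (hi n))))).
- apply: nearW => n /=; rewrite mulr_ge0 ?expR_ge0//=.
  rewrite /lo lnV ?posrE ?ltr0n// mulrN ler_piMr ?expR_ge0//.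
- exact: cvg_cst.
- exact: cvg_expN_scale cvg_ln_hi.
Qed.

Lemma cvg_power_exp_hi a : 0 < a ->
  (fun t => expR (a * ln t) * expR (- t)) \o hi @ \oo --> 0.
Proof.
(* Half of [ln_le_linear] at 2a gives a ln t <= t/2 + a ln(2a), which leaves a factor e^(-t/2) to
   tend to 0. *)
move=> a0; apply: (@squeeze_cvgr _ _ _ _ (cst 0)
  (fun n => expR (a * ln (2 * a)) * expR (- (2^-1 * hi n)))).
- apply: nearW => n /=; rewrite mulr_ge0 ?expR_ge0//= -!expRD ler_expR.
  have a20 : 0 < 2 * a by rewrite mulr_gt0.
  have hi0 : 0 < hi n :> R by rewrite ltr0n.
  by have := ln_le_linear a20 hi0; lra.
- exact: cvg_cst.
- rewrite -(mulr0 (expR (a * ln (2 * a)))); apply: cvgM; first exact: cvg_cst.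
  by apply: cvg_expN_scale (@cvg_hi R).
Qed.

Lemma dominated_cvg0 (g h : R -> R) (u : R^nat) : (forall n, 0 < u n) ->
  (forall t, 0 < t -> `|g t| <= h t) -> h \o u @ \oo --> 0 -> g \o u @ \oo --> 0.
Proof.
move=> u0 gh hu; apply/norm_cvg0P.
apply: (@squeeze_cvgr _ _ _ _ (cst 0) (h \o u)) => //; last exact: cvg_cst.
by apply: nearW => n /=; rewrite normr_ge0 gh.
Qed.

(** Integration by parts in primitive form: [G], the integrand of z Gamma(z) - Gamma(z + 1), is the
    derivative of [F], that is t^z e^(-t), which tends to 0 at both ends. *)
Lemma Gamma_succ z : 0 < complex.Re z -> Gamma (z + 1) = z * Gamma z.
Proof.
move=> z0; pose e t := expR (- t).
have z10 : 0 < complex.Re (z + 1) by rewrite ReD addr_gt0.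
pose F t := cpow t z * (e t)%:C.
pose G t := z * mellin_integrand e z t + - 1 * mellin_integrand e (z + 1) t.
have intz := Gamma_integrable z0; have intz1 := Gamma_integrable z10.
have intG : cintegrable G by apply: cintegrableD; exact: cintegrableZ.
suff : cintegral G = 0.
  rewrite cintegralD; [|exact: cintegrableZ..].
  by rewrite !cintegralZ// mulN1r => /eqP; rewrite subr_eq0 => /eqP ->.
have ReF t : complex.Re (F t) = complex.Re (cpow t z) * e t.
  by rewrite /F ReM /= mulr0 subr0.
have ImF t : complex.Im (F t) = complex.Im (cpow t z) * e t.
  by rewrite /F ImM /= mulr0 add0r.
have GE t : G t = (z * cpow t (z - 1) - cpow t z) * (e t)%:C.
  by rewrite /G /mellin_integrand addrK; ring.
have ReG t : complex.Re (G t) =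
    (complex.Re (z * cpow t (z - 1)) - complex.Re (cpow t z)) * e t.
  by rewrite GE ReM /= mulr0 subr0 ReD ReN.
have ImG t : complex.Im (G t) =
    (complex.Im (z * cpow t (z - 1)) - complex.Im (cpow t z)) * e t.
  by rewrite GE ImM /= mulr0 add0r ImD ImN.
have ceRe w t : 0 < t -> complex.Re (mellin_integrand e w x) @[x --> t] -->
    complex.Re (mellin_integrand e w t).
  by move=> t0; apply: continuous_Re_mellin_integrand t0 _; exact: continuous_expRN.
have ceIm w t : 0 < t -> complex.Im (mellin_integrand e w x) @[x --> t] -->
    complex.Im (mellin_integrand e w t).
  by move=> t0; apply: continuous_Im_mellin_integrand t0 _; exact: continuous_expRN.
have cRe t : 0 < t -> {for t, continuous (fun t => complex.Re (G t))}.
  move=> t0; rewrite /prop_for /continuous_at /G ReD !ReM.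
  under eq_fun do rewrite ReD !ReM.
  apply: cvgD; apply: cvgB; (apply: cvgM; first exact: cvg_cst).
  - exact: ceRe.
  - exact: ceIm.
  - exact: ceRe.
  - exact: ceIm.
have cIm t : 0 < t -> {for t, continuous (fun t => complex.Im (G t))}.
  move=> t0; rewrite /prop_for /continuous_at /G ImD !ImM.
  under eq_fun do rewrite ImD !ImM.
  apply: cvgD; apply: cvgD; (apply: cvgM; first exact: cvg_cst).
  - exact: ceIm.
  - exact: ceRe.
  - exact: ceIm.
  - exact: ceRe.
have dRe t : 0 < t -> is_derive t 1 (fun t => complex.Re (F t)) (complex.Re (G t)).
  move=> t0; have dc := is_derive_Re_cpow z t0.
  rewrite (_ : (fun t => _) = (fun t => complex.Re (cpow t z) * e t)); last first.
    exact/funext.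
  by rewrite ReG /e; apply: is_derive_eq; rewrite /GRing.scale/=; ring.
have dIm t : 0 < t -> is_derive t 1 (fun t => complex.Im (F t)) (complex.Im (G t)).
  move=> t0; have dc := is_derive_Im_cpow z t0.
  rewrite (_ : (fun t => _) = (fun t => complex.Im (cpow t z) * e t)); last first.
    exact/funext.
  by rewrite ImG /e; apply: is_derive_eq; rewrite /GRing.scale/=; ring.
pose h t := expR (complex.Re z * ln t) * e t.
have Reh t : 0 < t -> `|complex.Re (F t)| <= h t.
  move=> t0; rewrite ReF normrM (ger0_norm (expR_ge0 _)) ler_wpM2r ?expR_ge0//.
  exact: Re_cpow_le.
have Imh t : 0 < t -> `|complex.Im (F t)| <= h t.
  move=> t0; rewrite ImF normrM (ger0_norm (expR_ge0 _)) ler_wpM2r ?expR_ge0//.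
  exact: Im_cpow_le.
have lo0 := @lo_gt0 R; have hi0 n : 0 < hi n :> R by rewrite ltr0n.
have cvgl := cvg_power_exp_lo z0; have cvgh := cvg_power_exp_hi z0.
rewrite /cintegral.
rewrite (continuous_FTC2_halfline dRe cRe intG.1
  (dominated_cvg0 lo0 Reh cvgl) (dominated_cvg0 hi0 Reh cvgh)).
rewrite (continuous_FTC2_halfline dIm cIm intG.2
  (dominated_cvg0 lo0 Imh cvgl) (dominated_cvg0 hi0 Imh cvgh)).
by rewrite subrr.
Qed.

Lemma Gamma_rising z n : 0 < complex.Re z ->
  Gamma (z + n%:R) = (\prod_(j < n) (z + j%:R)) * Gamma z.
Proof.
move=> z0; elim: n => [|n IH]; first by rewrite addr0 big_ord0 mul1r.
rewrite -natr1 addrA Gamma_succ; last by rewrite ReD Re_nat ltr_wpDr.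
by rewrite IH big_ord_recr/=; ring.
Qed.

Lemma Gamma1 : Gamma (1 : R[i]) = 1.
Proof.
have int1 := @Gamma_integrable 1 ltr01.
have E t : mellin_integrand (fun t => expR (- t)) 1 t = (expR (- t))%:C.
  by rewrite /mellin_integrand subrr cpow0 mul1r.
have int1' : mu.-integrable `]0, +oo[ (EFin \o (fun t => expR (- t))).
  by apply: eq_integrable int1.1 => // t _; rewrite E.
have dF t : 0 < t -> is_derive t 1 (fun t => - expR (- t)) (expR (- t)).
  by move=> _; apply: is_derive_eq; rewrite /GRing.scale/=; ring.
have cv0 : (fun t => - expR (- t)) \o @lo R @ \oo --> (- 1 : R).
  rewrite -[X in - X]expR0 -oppr0; apply: cvgN.
  apply: continuous_cvg; first exact: continuous_expR.
  by apply: cvgN; exact: cvg_lo.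
have cvy : (fun t => - expR (- t)) \o @hi R @ \oo --> (0 : R).
  rewrite -oppr0; apply: cvgN.
  have := cvg_expN_scale ltr01 (@cvg_hi R).
  by under eq_fun do rewrite mul1r.
rewrite /Gamma /mellin (@eq_cintegral _ _ (fun t => (expR (- t))%:C)); last first.
  by move=> t _; exact: E.
rewrite /cintegral (continuous_FTC2_halfline dF _ int1' cv0 cvy).
  by rewrite sub0r opprK /Rintegral integral0.
by move=> t _; exact: continuous_expRN.
Qed.

Lemma Gamma_nat_neq0 n : Gamma (n.+1%:R : R[i]) != 0.
Proof.
rewrite -natr1 addrC Gamma_rising//= Gamma1 mulr1; apply/prodf_neq0 => j _.
by rewrite -mulrS pnatr_eq0.
Qed.

Lemma cintegrable_sqr_substitution (F : R -> R[i]) a : 0 < a ->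
  (forall t, 0 < t -> {for t, continuous (fun t => complex.Re (F t))}) ->
  (forall t, 0 < t -> {for t, continuous (fun t => complex.Im (F t))}) ->
  cintegrable F -> cintegrable (fun t => F (a * t ^+ 2) * (2 * a * t)%:C).
Proof.
move=> a0 cRe cIm [ReF ImF]; split.
- apply: eq_integrable (integrable_sqr_substitution a0 cRe ReF) => // t _.
  by rewrite ReM /= mulr0 subr0.
- apply: eq_integrable (integrable_sqr_substitution a0 cIm ImF) => // t _.
  by rewrite ImM /= mulr0 add0r.
Qed.

Lemma cintegral_sqr_substitution (F : R -> R[i]) a : 0 < a ->
  (forall t, 0 < t -> {for t, continuous (fun t => complex.Re (F t))}) ->
  (forall t, 0 < t -> {for t, continuous (fun t => complex.Im (F t))}) ->
  cintegrable F ->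
  cintegral F = cintegral (fun t => F (a * t ^+ 2) * (2 * a * t)%:C).
Proof.
move=> a0 cRe cIm [ReF ImF]; rewrite /cintegral.
rewrite (sqr_substitution a0 cRe ReF) (sqr_substitution a0 cIm ImF).
congr (_ +i* _); apply: eq_Rintegral => t _.
- by rewrite ReM /= mulr0 subr0.
- by rewrite ImM /= mulr0 add0r.
Qed.

(** Euler's integral for Gamma(s/2) under the substitution u = a t^2. *)
Lemma mellin_gauss a s : 0 < a -> 0 < complex.Re s ->
  mellin_integrable (fun t => expR (- (a * t ^+ 2))) s /\
  mellin (fun t => expR (- (a * t ^+ 2))) s =
    2^-1 * cpow a (- s / 2) * Gamma (s / 2).
Proof.
move=> a0 s0; have s20 : 0 < complex.Re (s / 2) by rewrite Re_half divr_gt0.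
have intG := Gamma_integrable s20.
pose F := mellin_integrand (fun t => expR (- t)) (s / 2).
have cRe t : 0 < t -> {for t, continuous (fun t => complex.Re (F t))}.
  by move=> t0; apply: continuous_Re_mellin_integrand t0 _; exact: continuous_expRN.
have cIm t : 0 < t -> {for t, continuous (fun t => complex.Im (F t))}.
  by move=> t0; apply: continuous_Im_mellin_integrand t0 _; exact: continuous_expRN.
have E t : 0 < t -> 2^-1 * cpow a (- s / 2) * (F (a * t ^+ 2) * (2 * a * t)%:C) =
    mellin_integrand (fun t => expR (- (a * t ^+ 2))) s t.
  move=> t0; rewrite /F /mellin_integrand cpowMl ?exprn_gt0// cpow_sqr//.
  have -> : cpow a (s / 2 - 1) = (a^-1)%:C * cpow a (s / 2) by rewrite cpowB1.
  have -> : 2 * (s / 2 - 1) = s - 1 - 1 by field.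
  rewrite (cpowB1 (s - 1))//.
  (* The factors are grouped into three products equal to 1, in front of the wanted integrand. *)
  transitivity (cpow a (- (s / 2)) * cpow a (s / 2) * (a^-1 * a)%:C *
    (t^-1 * t)%:C * (cpow t (s - 1) * (expR (- (a * t ^+ 2)))%:C)).
    have rcM (x y : R) : (x * y)%:C = x%:C * y%:C by rewrite rmorphM.
    by rewrite !rcM -natc mulNr; move: (a^-1)%:C (t^-1)%:C => a1 t1; field.
  by rewrite cpowN !mulVf ?gt_eqF// !mul1r.
split.
  apply: eq_cintegrable E _; apply: cintegrableZ.
  exact: cintegrable_sqr_substitution.
rewrite /mellin -(eq_cintegral E) cintegralZ; last first.
  exact: cintegrable_sqr_substitution.
by rewrite -cintegral_sqr_substitution.
Qed.

(** At a = s = 1 the Gaussian Mellin transform is the Gauss integral on the half-line. *)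
Lemma Gamma_half : Gamma (2^-1 : R[i]) = (Num.sqrt pi)%:C.
Proof.
have [_] := @mellin_gauss 1 1 ltr01 ltr01.
have -> : cpow (1 : R) (- 1 / 2) = 1 by rewrite cpowE ln1 !mulr0 expR0 cos0 sin0 mulr0 mul1r.
rewrite mulr1 !mul1r /mellin.
rewrite (@eq_cintegral _ _ (fun t => (expR (- t ^+ 2))%:C)); last first.
  by move=> t _; rewrite /mellin_integrand subrr cpow0 !mul1r.
rewrite /cintegral /Rintegral integral0/=.
rewrite integral_itv_obnd_cbnd; last first.
  by apply/measurable_EFinP/measurable_funTS; exact: measurable_gauss_fun.
rewrite integral0y_gauss/= => h.
have -> : Gamma (2^-1 : R[i]) = 2 * (2^-1 * Gamma 2^-1) by field.
by rewrite -h -[2 in LHS](rmorph_nat (real_complex R)) -rmorphM/=; congr (_%:C); field.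
Qed.

End gamma.

(** * The Beta integral *)

Section beta.
Context {R : realType}.
Implicit Types (s z : R[i]) (a t v : R).
Local Notation mu := (@lebesgue_measure R).
Local Notation D := (`]0%R, +oo[%classic : set R).

(** Absolute integrability is checked in one order only, through the majorant [N] and its integral
    [h]. Fubini alone controls almost every section; integrability of [f t] for each t > 0 makes the
    inner real integral meaningful everywhere. *)
Lemma halfline_fubini (f N : R -> R -> R) (h : R -> R) :
  measurable_fun setT (fun p : R * R => f p.1 p.2) ->
  (forall t v, 0 < t -> 0 < v -> `|f t v| <= N t v) ->
  (forall v, 0 < v -> mu.-integrable D (EFin \o (N ^~ v))) ->
  (forall v, 0 < v -> \int[mu]_(t in D) N t v = h v) ->
  mu.-integrable D (EFin \o h) ->
  (forall t, 0 < t -> mu.-integrable D (EFin \o f t)) ->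
  mu.-integrable D (EFin \o (fun t => \int[mu]_(v in D) f t v)) /\
  \int[mu]_(t in D) (\int[mu]_(v in D) f t v) =
  \int[mu]_(v in D) (\int[mu]_(t in D) f t v).
Proof.
move=> mf fN intN Nh inth intft.
(* Extension by zero off the quadrant, so that Fubini applies on the whole plane; [g1] and [g2]
   identify the inner integrals. *)
pose g (p : R * R) := (f p.1 p.2 * \1_D p.1 * \1_D p.2)%:E.
have mg : measurable_fun setT g.
  apply/measurable_EFinP; apply: measurable_funM; first apply: measurable_funM => //.
  - by apply: measurableT_comp => //; exact: measurable_indic.
  - by apply: measurableT_comp => //; exact: measurable_indic.
have mft v : 0 < v -> measurable_fun D (f ^~ v).
  move=> v0; apply: measurable_funTS.
  exact: (measurableT_comp mf (measurable_pair2 _)).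
have intfv v : 0 < v -> mu.-integrable D (EFin \o (f ^~ v)).
  move=> v0; apply: le_integrable (intN v v0) => //.
    by apply/measurable_EFinP; exact: mft.
  move=> t /=; rewrite in_itv/= andbT => t0; rewrite lee_fin.
  by rewrite (le_trans (fN _ _ t0 v0))// ler_norm.
have g1 t : (\int[mu]_v g (t, v) = ((fun t => (\int[mu]_(v in D) f t v)%:E) \_ D) t)%E.
  rewrite patchE; case: ifPn => tD.
    rewrite /Rintegral fineK; last first.
      by apply: integrable_fin_num => //; apply: intft; move: tD; rewrite inE/= in_itv/= andbT.
    rewrite [RHS]integral_mkcond; apply: eq_integral => v _.
    rewrite /g /= patchE !indicE tD mulr1.
    by case: (v \in _); rewrite ?mulr1 ?mulr0.
  by apply: integral0_eq => v _; rewrite /g /= !indicE (negbTE tD) mulr0 mul0r.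
have g2 v : (\int[mu]_t g (t, v) = ((fun v => (\int[mu]_(t in D) f t v)%:E) \_ D) v)%E.
  rewrite patchE; case: ifPn => vD.
    rewrite /Rintegral fineK; last first.
      by apply: integrable_fin_num => //; apply: intfv; move: vD; rewrite inE/= in_itv/= andbT.
    rewrite [RHS]integral_mkcond; apply: eq_integral => t _.
    rewrite /g /= patchE !indicE vD mulr1.
    by case: (t \in _); rewrite ?mulr1 ?mulr0.
  by apply: integral0_eq => t _; rewrite /g /= !indicE (negbTE vD) mulr0.
(* Tonelli with t inside and v outside: the inner integral of |g| is at most [h v]. *)
have intg : (mu \x mu)%E.-integrable setT g.
  apply/integrable21ltyP => //.
  have /integrableP[_] := inth; apply: le_lt_trans.
  rewrite [leRHS]integral_mkcond.
  apply: ge0_le_integral => //.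
  - by move=> v _; exact: integral_ge0.
  - have mag : measurable_fun setT (abse \o g) by exact: measurableT_comp.
    exact: (@measurable_fun_fubini_tonelli_G _ _ _ _ R mu _ mag (fun=> abse_ge0 _)).
  - apply/(measurable_restrictT _ _).1 => //.
    by apply: measurableT_comp => //; exact: measurable_int inth.
  - move=> v _; rewrite patchE; case: ifPn => vD.
      have v0 : 0 < v by move: vD; rewrite inE/= in_itv/= andbT.
      have -> : (\int[mu]_t `|g (t, v)| = \int[mu]_(t in D) `|(f t v)%:E|)%E.
        rewrite [RHS]integral_mkcond; apply: eq_integral => t _.
        rewrite /g /= patchE !indicE vD mulr1.
        by case: (t \in _); rewrite ?mulr1 ?mulr0 ?normr0.
      rewrite /= -(Nh v v0).
      apply: (@le_trans _ _ (\int[mu]_(t in D) N t v)%:E); last first.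
        by rewrite lee_fin ler_norm.
      rewrite /Rintegral fineK; last by apply: integrable_fin_num => //; exact: intN.
      apply: ge0_le_integral => //.
      + by apply/measurable_EFinP/measurableT_comp => //; exact: mft.
      + exact: measurable_int (intN v v0).
      + by move=> t; rewrite /= in_itv/= andbT => t0; rewrite lee_fin fN.
    rewrite integral0_eq// => t _.
    by rewrite /g /= !indicE (negbTE vD) mulr0 normr0.
have intF := integrable_fubini_F intg.
split.
  apply/integrable_mkcond => //.
  apply: eq_integrable intF => // t _; rewrite /fubini_F.
  exact: g1.
have := Fubini intg.
under eq_integral do rewrite g1.
under [RHS]eq_integral do rewrite g2.
by rewrite -!integral_mkcond /Rintegral => ->.
Qed.

(** The real nonnegative factor of the Beta integrand, kept apart because the complex kernel and its
    majorant share it. *)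
Definition beta_weight (w t v : R) : R :=
  expR ((w - 1) * ln v) * expR (- ((1 + t ^+ 2) * v ^+ 2)).

Definition beta_kernel (z : R[i]) (w t v : R) : R[i] :=
  cpow t (z - 1) * (beta_weight w t v)%:C.

(** In v, the kernel is a Gaussian Mellin integrand at w with parameter 1 + t^2. *)
Lemma integral_beta_kernel_r z (w : R) t : 0 < w -> 0 < t ->
  cintegrable (beta_kernel z w t) /\
  cintegral (beta_kernel z w t) = 2^-1 * Gamma (w%:C / 2) *
    mellin_integrand (fun t => expR (- (w / 2) * ln (1 + t ^+ 2))) z t.
Proof.
move=> w0 t0; have t1 : 0 < 1 + t ^+ 2 by rewrite addr_gt0// exprn_gt0.
have [intG G] := @mellin_gauss R _ w%:C t1 w0.
have E v : 0 < v -> cpow t (z - 1) *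
    mellin_integrand (fun v => expR (- ((1 + t ^+ 2) * v ^+ 2))) w%:C v = beta_kernel z w t v.
  move=> v0; rewrite /beta_kernel /beta_weight /mellin_integrand.
  have -> : w%:C - 1 = (w - 1)%:C by rewrite rmorphB.
  by rewrite cpow_real [in RHS]rmorphM.
split; first by apply: eq_cintegrable E _; exact: cintegrableZ.
rewrite -[LHS](eq_cintegral E) (cintegralZ _ intG); rewrite /mellin in G.
rewrite G /mellin_integrand.
have -> : - w%:C / 2 = (- (w / 2))%:C.
  by rewrite rmorphN rmorphM fmorphV rmorph_nat mulNr.
by rewrite cpow_real; ring.
Qed.

(** In t, the Gaussian parameter is v^2; the resulting v^(-z) joins v^(w-1) and leaves a Gaussian
    Mellin integrand at w - z, with the parameter 1 displayed as [mellin_gauss] expects. *)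
Lemma integral_beta_kernel_l z (w : R) v : 0 < complex.Re z -> 0 < v ->
  cintegrable (beta_kernel z w ^~ v) /\
  cintegral (beta_kernel z w ^~ v) = 2^-1 * Gamma (z / 2) *
    mellin_integrand (fun v => expR (- (1 * v ^+ 2))) (w%:C - z) v.
Proof.
move=> z0 v0; have v20 : 0 < v ^+ 2 by rewrite exprn_gt0.
have [intG G] := mellin_gauss v20 z0.
have qE t : (beta_weight w t v)%:C = cpow v (w%:C - 1) * (expR (- (1 * v ^+ 2)))%:C *
    (expR (- (v ^+ 2 * t ^+ 2)))%:C.
  have -> : w%:C - 1 = (w - 1)%:C by rewrite rmorphB.
  rewrite cpow_real -!rmorphM -mulrA -expRD /beta_weight; congr (_ * expR _)%:C; ring.
have E t : 0 < t -> cpow v (w%:C - 1) * (expR (- (1 * v ^+ 2)))%:C *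
    mellin_integrand (fun t => expR (- (v ^+ 2 * t ^+ 2))) z t = beta_kernel z w t v.
  by move=> t0; rewrite /beta_kernel qE /mellin_integrand; ring.
split; first by apply: eq_cintegrable E _; exact: cintegrableZ.
rewrite -[LHS](eq_cintegral E) (cintegralZ _ intG); rewrite /mellin in G.
rewrite G /mellin_integrand.
rewrite cpow_sqr//; have -> : 2 * (- z / 2) = - z by field.
have -> : w%:C - z - 1 = w%:C - 1 - z by ring.
by rewrite [cpow v (_ - z)]cpowD; ring.
Qed.

Lemma mellin_beta z (w : R) : 0 < complex.Re z -> complex.Re z < w ->
  Gamma (w%:C / 2) != 0 ->
  let f := fun t => expR (- (w / 2) * ln (1 + t ^+ 2)) in
  mellin_integrable f z /\
  Gamma (w%:C / 2) * mellin f z =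
    2^-1 * Gamma (z / 2) * Gamma ((w%:C - z) / 2).
Proof.
move=> z0 zw Gw0 f; pose x := complex.Re z.
pose q := beta_weight w; pose F := beta_kernel z w.
(* At the real point [x] the kernel is real and nonnegative, and it bounds the real and imaginary
   parts of [F]. *)
pose N t v := complex.Re (beta_kernel x%:C w t v).
have Fv t (t0 : 0 < t) := integral_beta_kernel_r z (lt_trans z0 zw) t0.
have Ft v (v0 : 0 < v) := integral_beta_kernel_l w z0 v0.
have Nt v (v0 : 0 < v) := @integral_beta_kernel_l x%:C w v z0 v0.
have q0 t v : 0 <= q t v by rewrite /q /beta_weight mulr_ge0 ?expR_ge0.
have NE t v : N t v = expR ((x - 1) * ln t) * q t v.
  rewrite /N /beta_kernel; have -> : x%:C - 1 = (x - 1)%:C by rewrite rmorphB.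
  by rewrite cpow_real -rmorphM.
have xE : complex.Re (z - 1) = x - 1 by rewrite ReD ReN.
have ReF t v : complex.Re (F t v) = complex.Re (cpow t (z - 1)) * q t v.
  by rewrite /F /beta_kernel ReM /= mulr0 subr0.
have ImF t v : complex.Im (F t v) = complex.Im (cpow t (z - 1)) * q t v.
  by rewrite /F /beta_kernel ImM /= mulr0 add0r.
have leReN t v : 0 < t -> 0 < v -> `|complex.Re (F t v)| <= N t v.
  move=> _ _; rewrite ReF NE normrM (ger0_norm (q0 _ _)) ler_wpM2r//.
  by rewrite -xE Re_cpow_le.
have leImN t v : 0 < t -> 0 < v -> `|complex.Im (F t v)| <= N t v.
  move=> _ _; rewrite ImF NE normrM (ger0_norm (q0 _ _)) ler_wpM2r//.
  by rewrite -xE Im_cpow_le.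
have mq : measurable_fun setT (fun p : R * R => q p.1 p.2).
  have m1 : measurable_fun setT (fun p : R * R => p.1) by exact: measurable_fst.
  have m2 : measurable_fun setT (fun p : R * R => p.2) by exact: measurable_snd.
  apply: measurable_funM.
    apply: (measurableT_comp (@measurable_expR R)); apply: measurable_funM => //.
    exact: (measurableT_comp (@measurable_ln R) m2).
  apply: (measurableT_comp (@measurable_expR R)).
  apply: (measurableT_comp (@oppr_measurable R setT)); apply: measurable_funM.
    by apply: measurable_funD => //; exact: measurable_funX.
  exact: measurable_funX.
have mRe : measurable_fun setT (fun p : R * R => complex.Re (F p.1 p.2)).
  rewrite (_ : (fun p : R * R => _) =
    (fun p => complex.Re (cpow p.1 (z - 1)) * q p.1 p.2)); last exact/funext.
  apply: measurable_funM => //.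
  exact: (measurableT_comp (measurable_Re_cpow (z - 1)) measurable_fst).
have mIm : measurable_fun setT (fun p : R * R => complex.Im (F p.1 p.2)).
  rewrite (_ : (fun p : R * R => _) =
    (fun p => complex.Im (cpow p.1 (z - 1)) * q p.1 p.2)); last exact/funext.
  apply: measurable_funM => //.
  exact: (measurableT_comp (measurable_Im_cpow (z - 1)) measurable_fst).
(* The inner integral of [N], read off [integral_beta_kernel_l]; it is integrable because w - x >
   0. *)
pose h v := complex.Re (2^-1 * Gamma (x%:C / 2) *
    mellin_integrand (fun v => expR (- (1 * v ^+ 2))) (w%:C - x%:C) v).
have wx0 : 0 < complex.Re (w%:C - x%:C) by rewrite ReD ReN /= subr_gt0.
have inth : mu.-integrable D (EFin \o h).
  have [intG _] := mellin_gauss (@ltr01 R) wx0.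
  exact: (cintegrableZ _ intG).1.
have intN v : 0 < v -> mu.-integrable D (EFin \o (N ^~ v)).
  by move=> /Nt[[]].
have Nh v : 0 < v -> \int[mu]_(t in D) N t v = h v.
  by move=> /Nt[_]; rewrite /h => <-.
have intRet t : 0 < t -> mu.-integrable D (EFin \o (fun v => complex.Re (F t v))).
  by move=> /Fv[[]].
have intImt t : 0 < t -> mu.-integrable D (EFin \o (fun v => complex.Im (F t v))).
  by move=> /Fv[[]].
have [intRe eqRe] := halfline_fubini mRe leReN intN Nh inth intRet.
have [intIm eqIm] := halfline_fubini mIm leImN intN Nh inth intImt.
have intF : cintegrable (fun t => cintegral (F t)) by split; [exact: intRe|exact: intIm].
have eqF : cintegral (fun t => cintegral (F t)) = cintegral (fun v => cintegral (F ^~ v)).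
  by rewrite {1}/cintegral eqRe eqIm.
(* Dividing by this constant turns integrability of the iterated integral into integrability of the
   Mellin integrand of [f]. *)
have c0 : 2^-1 * Gamma (w%:C / 2) != 0 :> R[i] by rewrite mulf_neq0// invr_eq0 pnatr_eq0.
have intf : mellin_integrable f z.
  have := cintegrableZ (2^-1 * Gamma (w%:C / 2))^-1 intF.
  by apply: eq_cintegrable => t t0; rewrite (Fv _ t0).2 mulKf.
split; first exact: intf.
have wz0 : 0 < complex.Re (w%:C - z) by rewrite ReD ReN /= subr_gt0.
have [intG G] := mellin_gauss (@ltr01 R) wz0.
rewrite /mellin in G *.
have e1 t : 0 < t -> cintegral (F t) =
  2^-1 * Gamma (w%:C / 2) * mellin_integrand f z t by move=> /Fv[].
have e2 v : 0 < v -> cintegral (F ^~ v) = 2^-1 * Gamma (z / 2) *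
  mellin_integrand (fun v => expR (- (1 * v ^+ 2))) (w%:C - z) v by move=> /Ft[].
move: eqF; rewrite [LHS](eq_cintegral e1) [RHS](eq_cintegral e2).
rewrite (cintegralZ _ intf) (cintegralZ _ intG) G.
have -> : cpow (1 : R) (- (w%:C - z) / 2) = 1.
  by rewrite cpowE ln1 !mulr0 expR0 cos0 sin0 mulr0 mul1r.
rewrite mulr1.
move: (cintegral _) (Gamma (w%:C / 2)) (Gamma (z / 2)) (Gamma ((w%:C - z) / 2)).
move=> I a b c abc; have -> : a * I = 2 * (2^-1 * a * I) by field.
by rewrite abc; field.
Qed.

End beta.

(** * Hermite polynomials *)

Section hermite_polynomials.
Context {R : realType}.
Implicit Types (n m k i j : nat) (x t : R).

(** The three-term recurrence, from which the constant coefficients are immediate; the form H_(n+1)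
    = 2X H_n - H_n', which differentiation produces, is derived from it. *)
Fixpoint hermite_poly n : {poly R} :=
  match n with
  | 0 => 1
  | n1.+1 => match n1 with
    | 0 => 'X *+ 2
    | n2.+1 => 'X *+ 2 * hermite_poly n1 - hermite_poly n2 *+ (2 * n1)
    end
  end.

Lemma hermite_polySS n : hermite_poly n.+2 =
  'X *+ 2 * hermite_poly n.+1 - hermite_poly n *+ (2 * n.+1).
Proof. by []. Qed.

(** The induction carries two consecutive ranks because the recurrence reaches back two steps. *)
Lemma deriv_hermite_poly n :
  deriv (hermite_poly n.+1) = hermite_poly n *+ (2 * n.+1).
Proof.
suff : deriv (hermite_poly n.+1) = hermite_poly n *+ (2 * n.+1) /\
  deriv (hermite_poly n.+2) = hermite_poly n.+1 *+ (2 * n.+2) by case.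
elim: n => [|n [IH1 IH2]].
  have d1 : deriv (hermite_poly 1) = hermite_poly 0 *+ 2.
    by rewrite /= derivMn derivX.
  split=> //; rewrite hermite_polySS derivB derivM !derivMn !derivX.
  by rewrite /= derivC; ring.
split=> //; rewrite hermite_polySS derivB derivM derivMn derivX derivMn IH2 IH1.
rewrite hermite_polySS; move: (hermite_poly n.+1) (hermite_poly n) => p q.
by ring.
Qed.

Lemma hermite_poly_step n : hermite_poly n.+1 =
  'X *+ 2 * hermite_poly n - deriv (hermite_poly n).
Proof.
case: n => [|n]; first by rewrite /= derivC subr0 mulr1.
by rewrite deriv_hermite_poly.
Qed.

(** The exponential is e^(x^2) e^(-(x-t)^2), so its derivatives are polynomials in x - t times
    itself. A formula at every t is what allows the induction to differentiate again. *)
Lemma derive1n_hermite n x :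
  derive1n n (fun t => expR (- t ^+ 2 + 2 * x * t)) =
  fun t => (hermite_poly n).[x - t] * expR (- t ^+ 2 + 2 * x * t).
Proof.
elim: n => [|n IH]; first by apply/funext => t; rewrite /= hornerC mul1r.
rewrite derive1nS IH; apply/funext => t; rewrite derive1E.
pose q t := (hermite_poly n).[x - t].
have dq : is_derive t 1 q (- (deriv (hermite_poly n)).[x - t]).
  have dxt : is_derive t 1 (fun t => x - t) (-1).
    by have := is_deriveB (is_derive_cst x t 1) (is_derive_id t 1); rewrite sub0r.
  have := @is_derive1_comp R (horner (hermite_poly n)) (fun t => x - t) t _ _
    (is_derive_poly _ _) dxt.
  by rewrite mulrN1.
have dE : is_derive t 1 (fun t => q t * expR (- t ^+ 2 + 2 * x * t))
    ((hermite_poly n.+1).[x - t] * expR (- t ^+ 2 + 2 * x * t)).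
  apply: is_derive_eq.
  rewrite hermite_poly_step !hornerE /GRing.scale/= -/(q t).
  by ring.
exact: derive_val.
Qed.

Lemma hermiteE n x : hermite n x = (hermite_poly n).[x].
Proof.
by rewrite /hermite derive1n_hermite subr0 expr0n/= oppr0 mulr0 addr0 expR0 mulr1.
Qed.

(** Differentiating lowers both rank and coefficient index by one; after i steps only the constant
    coefficient of H_n is left. *)
Lemma coef_hermite_poly n i : (hermite_poly (n + i))`_i =
  'C(n + i, i)%:R * 2 ^+ i * (hermite_poly n)`_0.
Proof.
elim: i => [|i IH]; first by rewrite addn0 bin0 !mul1r.
have := coef_deriv (hermite_poly (n + i.+1)) i.
rewrite addnS deriv_hermite_poly coefMn IH => /esym.
rewrite -[X in X = _]mulr_natr -[X in _ = X]mulr_natr => h.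
have iN0 : (i.+1%:R : R) != 0 by rewrite pnatr_eq0.
apply: (mulIf iN0); rewrite h.
have := congr1 (fun k => k%:R : R) (mul_bin_diag (n + i).+1 i); rewrite /= !natrM exprS.
move: ((n + i).+1%:R : R) (i.+1%:R : R) => a b.
move: ('C(n + i, i)%:R : R) ('C((n + i).+1, i.+1)%:R : R) => c d acbd.
transitivity (a * c * 2 * 2 ^+ i * (hermite_poly n)`_0); first by ring.
by rewrite acbd; ring.
Qed.

Lemma coef0_hermite_polySS n :
  (hermite_poly n.+2)`_0 = - (2 * n.+1%:R) * (hermite_poly n)`_0.
Proof.
rewrite hermite_polySS ['X *+ 2 * _]mulrnAl coefB !coefMn coefXM/= mul0rn sub0r.
by move: (_`_0) => c; ring.
Qed.

Lemma coef0_hermite_poly_odd j : (hermite_poly j.*2.+1)`_0 = 0.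
Proof.
elim: j => [|j IH]; first by rewrite /= coefMn coefX mul0rn.
by rewrite doubleS coef0_hermite_polySS IH mulr0.
Qed.

Lemma coef0_hermite_poly_even j :
  (hermite_poly j.*2)`_0 = (-1) ^+ j * (j.*2)`!%:R / j`!%:R.
Proof.
elim: j => [|j IH]; first by rewrite /= coefC /= fact0 invr1 !mulr1.
rewrite doubleS coef0_hermite_polySS IH !factS !natrM exprS -!natr1 -muln2 natrM.
by field; rewrite !natr1 !pnatr_eq0 -lt0n fact_gt0.
Qed.

Lemma size_hermite_poly n : (size (hermite_poly n) <= n.+1)%N.
Proof.
suff : (size (hermite_poly n) <= n.+1)%N /\ (size (hermite_poly n.+1) <= n.+2)%N by case.
elim: n => [|n [IH1 IH2]].
  by rewrite size_poly1 /= -scaler_nat (leq_trans (size_scale_leq _ _))// size_polyX.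
split=> //; rewrite hermite_polySS (leq_trans (size_polyD _ _))// geq_max; apply/andP; split.
  rewrite mulrnAl -scaler_nat (leq_trans (size_scale_leq _ _))//.
  by rewrite (leq_trans (size_polyMleq _ _))// size_polyX.
rewrite size_polyN -scaler_nat (leq_trans (size_scale_leq _ _))//.
exact: (leq_trans IH1 (leqW (leqnSn _))).
Qed.

Lemma sum_even_odd (F : nat -> R) m : (forall k, F k.*2.+1 = 0) ->
  \sum_(i < m.*2.+1) F i = \sum_(k < m.+1) F k.*2.
Proof.
move=> F0; elim: m => [|m IH]; first by rewrite !big_ord1.
by rewrite doubleS 2!big_ord_recr/= IH F0 addr0 [RHS]big_ord_recr.
Qed.

Lemma hermite_even m x : hermite m.*2 x / (m.*2)`!%:R =
  \sum_(k < m.+1) (-1) ^+ (m - k) * 2 ^+ k.*2 / ((m - k)`!%:R * (k.*2)`!%:R) * x ^+ k.*2.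
Proof.
rewrite hermiteE (horner_coef_wide _ (size_hermite_poly _)).
rewrite (sum_even_odd (F := fun i => (hermite_poly m.*2)`_i * x ^+ i)); last first.
  (* An odd coefficient is beyond the size bound, or it reduces to the constant coefficient at the
     odd rank 2(m - k - 1) + 1, which is 0. *)
  move=> k; case: (ltnP k.*2.+1 m.*2.+1) => [km|mk]; last first.
    by rewrite nth_default ?mul0r// (leq_trans (size_hermite_poly _)).
  have km' : (k < m)%N by rewrite -ltn_double -ltnS.
  have e : m.*2 = ((m - k.+1).*2.+1 + k.*2.+1)%N.
    by rewrite addSnnS -doubleS -doubleD subnK.
  by rewrite e coef_hermite_poly coef0_hermite_poly_odd mulr0 mul0r.
rewrite mulr_suml; apply: eq_bigr => k _.
have km : (k <= m)%N by rewrite -ltnS.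
have e : m.*2 = ((m - k).*2 + k.*2)%N by rewrite -doubleD subnK.
rewrite {1}e coef_hermite_poly coef0_hermite_poly_even -e.
have km2 : (k.*2 <= m.*2)%N by rewrite leq_double.
have := congr1 (fun k => k%:R : R) (bin_fact km2).
rewrite -doubleB !natrM => <-.
have fN0 i : (i`!%:R : R) != 0 by rewrite pnatr_eq0 -lt0n fact_gt0.
have bN0 : ('C(m.*2, k.*2)%:R : R) != 0 by rewrite pnatr_eq0 -lt0n bin_gt0.
by field; rewrite bN0 !fN0.
Qed.

End hermite_polynomials.

(** * The polynomials Q_m *)

Section mellin_polynomial.
Context {R : realType}.
Implicit Types (n m k j : nat) (s z : R[i]) (x t : R) (Q : {poly R}).

Lemma realcM x t : (x * t)%:C = x%:C * t%:C :> R[i].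
Proof. by rewrite rmorphM. Qed.

Lemma mellin_integrandXn (f : R -> R) n s t : 0 < t ->
  mellin_integrand (fun t => t ^+ n * f t) s t =
  mellin_integrand f (s + n%:R) t.
Proof.
move=> t0; rewrite /mellin_integrand [in RHS]addrAC [in RHS]cpowD cpow_nat// realcM.
by rewrite mulrA.
Qed.

Lemma mellin_sum n (c : nat -> R) (f : nat -> R -> R) (g : R -> R) s :
  (forall t, 0 < t -> g t = \sum_(k < n) c k * f k t) ->
  (forall k, (k < n)%N -> mellin_integrable (f k) s) ->
  mellin_integrable g s /\
  mellin g s = \sum_(k < n) (c k)%:C * mellin (f k) s.
Proof.
move=> gE intf.
have E t : 0 < t -> \sum_(k < n) (c k)%:C * mellin_integrand (f k) s t =
    mellin_integrand g s t.
  move=> t0; rewrite /mellin_integrand gE// rmorph_sum mulr_sumr.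
  by apply: eq_bigr => k _; rewrite rmorphM/= mulrCA.
pose G k t := (c k)%:C * mellin_integrand (f k) s t.
have intG k : (k < n)%N -> cintegrable (G k) by move=> /intf; exact: cintegrableZ.
split; first exact: eq_cintegrable E (cintegrable_sum intG).
rewrite /mellin -[LHS](eq_cintegral E) (cintegral_sum intG).
by apply: eq_bigr => k _; rewrite (cintegralZ _ (intf k (ltn_ord k))).
Qed.

Lemma mellinXn (f : R -> R) n s : mellin_integrable f (s + n%:R) ->
  mellin_integrable (fun t => t ^+ n * f t) s /\
  mellin (fun t => t ^+ n * f t) s = mellin f (s + n%:R).
Proof.
move=> intf; split.
  by apply: eq_cintegrable intf => t t0; rewrite mellin_integrandXn.
by rewrite /mellin; apply: eq_cintegral => t t0; rewrite mellin_integrandXn.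
Qed.

Definition rising2 s k := \prod_(j < k) (s + (j.*2)%:R).

(** Each factor s/2 + j of Gamma(s/2 + k) / Gamma(s/2) takes one 2 and becomes s + 2j. *)
Lemma Gamma_rising2 s k : 0 < complex.Re s ->
  2 ^+ k * Gamma (s / 2 + k%:R) = rising2 s k * Gamma (s / 2).
Proof.
move=> s0; rewrite Gamma_rising ?Re_half ?divr_gt0// mulrA; congr (_ * _).
rewrite /rising2; elim: k => [|k IH]; first by rewrite !big_ord0 mulr1.
rewrite !big_ord_recr/= -IH exprS -muln2 natrM.
by move: (\prod_(i < k) _) => p; field.
Qed.

(** This is m! times the coefficient of x^(2k) in H_2m / (2m)!. *)
Definition mellin_coef m k : R :=
  (-1) ^+ (m - k) * m`!%:R * 2 ^+ k.*2 / ((m - k)`!%:R * (k.*2)`!%:R).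

Definition explicit_Qpoly m : {poly R} :=
  \sum_(k < m.+1) (mellin_coef m k)%:P * \prod_(j < k) ('X + (j.*2)%:R%:P).

Lemma ceval_explicit_Qpoly m s :
  ceval (explicit_Qpoly m) s = \sum_(k < m.+1) (mellin_coef m k)%:C * rising2 s k.
Proof.
rewrite /ceval /explicit_Qpoly rmorph_sum horner_sum; apply: eq_bigr => k _.
rewrite rmorphM/= hornerM map_polyC hornerC rmorph_prod horner_prod; congr (_ * _).
apply: eq_bigr => j _.
by rewrite rmorphD/= map_polyX map_polyC hornerD hornerX hornerC natc.
Qed.

(** The term x^(2k) shifts s to s + 2k in the Gaussian transform. The argument sqrt(2 pi) x supplies
    (2 pi)^k: its pi^k cancels the shift of pi^(-s/2), its 2^k is the one in [Gamma_rising2]. *)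
Lemma explicit_Qpoly_mellin m : is_mellin_poly m (explicit_Qpoly m).
Proof.
move=> s s0 /=.
pose e x : R := expR (- (pi * x ^+ 2)).
pose c k : R := (-1) ^+ (m - k) * 2 ^+ k.*2 / ((m - k)`!%:R * (k.*2)`!%:R) * (2 * pi) ^+ k.
have PhiE x : 0 < x -> Phi m.*2 x / (m.*2)`!%:R =
    \sum_(k < m.+1) c k * (x ^+ k.*2 * e x).
  move=> _; rewrite /Phi mulrAC hermite_even mulr_suml; apply: eq_bigr => k _.
  rewrite exprMn -[in Num.sqrt _ ^+ _]mul2n exprM sqr_sqrtr; last first.
    by rewrite mulr_ge0// pi_ge0.
  by rewrite /c /e; ring.
have sk0 k : 0 < complex.Re (s + (k.*2)%:R) by rewrite ReD Re_nat ltr_wpDr.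
have Xe k := mellinXn (mellin_gauss (@pi_gt0 R) (sk0 k)).1.
have [intPhi ->] := mellin_sum PhiE (fun k _ => (Xe k).1).
split; first exact: intPhi.
rewrite ceval_explicit_Qpoly mulr_suml mulr_sumr; apply: eq_bigr => k _.
rewrite (Xe k).2 (mellin_gauss (@pi_gt0 R) (sk0 k)).2.
have -> : (s + (k.*2)%:R) / 2 = s / 2 + k%:R.
  by rewrite -muln2 natrM; field.
have -> : - (s + (k.*2)%:R) / 2 = - s / 2 - k%:R.
  by rewrite -muln2 natrM; field.
have pik : cpow (@pi R) (- k%:R) * (@pi R ^+ k)%:C = 1.
  by rewrite -(cpow_nat k (@pi_gt0 R)) cpowN.
rewrite cpowD.
have cE : (c k)%:C = (mellin_coef m k)%:C / m`!%:R * 2 ^+ k * (@pi R ^+ k)%:C.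
  have -> : c k = mellin_coef m k / m`!%:R * 2 ^+ k * pi ^+ k.
    rewrite /c /mellin_coef exprMn; field.
    by rewrite !pnatr_eq0 -!lt0n !fact_gt0.
  by rewrite 3!realcM fmorphV rmorphXn/= -!natc.
have GR := Gamma_rising2 k s0.
rewrite cE; move: (mellin_coef m k)%:C (m`!%:R^-1) => a b.
move: (cpow pi (- s / 2)) (cpow pi (- k%:R)) pik => p q.
move: (@pi R ^+ k)%:C => r qr.
move: (Gamma (s / 2 + k%:R)) (Gamma (s / 2)) GR => g1 g2 GR.
transitivity (a * b * 2^-1 * p * (q * r) * (2 ^+ k * g1)); first by ring.
by rewrite qr GR; ring.
Qed.

Lemma ceval_real Q x : ceval Q x%:C = (Q.[x])%:C.
Proof. by rewrite /ceval horner_map. Qed.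

(** Both polynomials agree at s = 2, 4, 6, ..., where Gamma(s/2) is nonzero; the difference gets as
    many distinct roots as its size. *)
Lemma mellin_poly_unique m Q1 Q2 :
  is_mellin_poly m Q1 -> is_mellin_poly m Q2 -> Q1 = Q2.
Proof.
move=> M1 M2; apply/eqP; rewrite -subr_eq0; apply/eqP.
apply: (@roots_geq_poly_eq0 _ _ [seq (k.+1.*2)%:R | k <- iota 0 (size (Q1 - Q2))]).
- apply/allP => _ /mapP[k _ ->]; apply/rootP; rewrite hornerD hornerN.
  apply/eqP; rewrite subr_eq0; apply/eqP/complexI.
  rewrite -[LHS]ceval_real -[RHS]ceval_real.
  set s : R[i] := _%:C.
  have s0 : 0 < complex.Re s by rewrite /= ltr0n.
  have [_ e1] := M1 s s0; have [_ e2] := M2 s s0.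
  have s2 : s / 2 = k.+1%:R.
    by rewrite /s rmorph_nat -muln2 natrM; field.
  have pN0 : 2^-1 * cpow pi (- s / 2) * Gamma (s / 2) != 0.
    apply: mulf_neq0; last by rewrite s2 Gamma_nat_neq0.
    by apply: mulf_neq0; [rewrite invr_eq0 pnatr_eq0|exact: cpow_neq0].
  have /(mulfI pN0) := etrans (esym e1) e2.
  apply: mulIf; rewrite invr_eq0 pnatr_eq0 -lt0n fact_gt0//.
- rewrite map_inj_uniq ?iota_uniq// => i j /eqP.
  by rewrite eqr_nat => /eqP /double_inj [].
- by rewrite size_map size_iota.
Qed.

Lemma Qpoly_explicit m : Qpoly R m = explicit_Qpoly m.
Proof.
apply: (@mellin_poly_unique m); last exact: explicit_Qpoly_mellin.
by apply: xgetPex; exists (explicit_Qpoly m); exact: explicit_Qpoly_mellin.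
Qed.

(** Serves twice: it shows that the divisor in the Beta formula is nonzero, and it matches the
    coefficients of Psi_m with those of Q_m. *)
Lemma Gamma_half_nat k :
  Gamma ((k.*2.+1)%:R%:C / 2) = ((k.*2)`!%:R / (4 ^+ k * k`!%:R) * Num.sqrt pi)%:C :> R[i].
Proof.
have h0 : 0 < complex.Re (2^-1 : R[i]).
  by rewrite -[2^-1]mul1r Re_half divr_gt0.
have -> : ((k.*2.+1)%:R)%:C / 2 = 2^-1 + k%:R :> R[i].
  by rewrite rmorph_nat -natr1 -muln2 natrM; field.
rewrite Gamma_rising// Gamma_half realcM; congr (_ * _).
elim: k => [|k IH]; first by rewrite big_ord0 fact0 expr0 mul1r divr1.
rewrite big_ord_recr/= IH.
have -> : 2^-1 + k%:R = (2^-1 + k%:R)%:C :> R[i] by rewrite rmorphD fmorphV !rmorph_nat.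
rewrite -realcM; congr (_%:C).
rewrite doubleS !factS !natrM exprS -!natr1 -muln2 natrM.
by field; rewrite !natr1 !pnatr_eq0 -lt0n fact_gt0 expf_neq0.
Qed.

(** * Expansion of Psi_m and Mellin transforms of its terms *)

Definition beta_fun k t : R := expR (- ((k.*2.+1)%:R / 2) * ln (1 + t ^+ 2)).

Lemma beta_funE k t : beta_fun k t = (1 + t ^+ 2) ^- k / Num.sqrt (1 + t ^+ 2).
Proof.
have u0 : 0 < 1 + t ^+ 2 by rewrite ltr_wpDr// sqr_ge0.
have uE : Num.sqrt (1 + t ^+ 2) = expR (ln (1 + t ^+ 2) / 2).
  rewrite -[LHS]/(Num.sqrt _) -{1}[1 + t ^+ 2]lnK ?posrE//.
  rewrite -{1}[ln _](divfK (_ : 2 != 0)) ?pnatr_eq0// expRM_natr sqrtr_sqr.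
  by rewrite ger0_norm// expR_ge0.
rewrite uE -[in _ ^- k](@lnK _ (1 + t ^+ 2)) ?posrE// -expRM_natl -!expRN -expRD.
by rewrite /beta_fun; congr expR; rewrite -natr1 -muln2 natrM; field.
Qed.

Definition Psi_coef m k : R :=
  Num.sqrt 2 * 'C(m, k)%:R * (-1) ^+ (m - k) * 2 ^+ k.

Lemma PsiE m t :
  Psi m t = \sum_(k < m.+1) Psi_coef m k * (t ^+ k.*2 * beta_fun k t).
Proof.
have u0 : 1 + t ^+ 2 != 0 by rewrite gt_eqF// ltr_wpDr// sqr_ge0.
rewrite /Psi.
have -> : (t ^+ 2 - 1) / (t ^+ 2 + 1) = -1 + 2 * t ^+ 2 / (1 + t ^+ 2).
  by rewrite [t ^+ 2 + 1]addrC; field; rewrite ?u0.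
rewrite exprDn mulr_sumr mulr_suml; apply: eq_bigr => k _.
rewrite /Psi_coef beta_funE -[_ *+ 'C(_, _)]mulr_natr (exprMn k (2 * t ^+ 2)) (exprMn k 2).
rewrite exprVn -exprM mul2n.
by move: (Num.sqrt (1 + t ^+ 2))^-1 ((1 + t ^+ 2) ^- k) => a b; ring.
Qed.

(** The last factor is Gamma((2k+1)/2), to be absorbed by the Beta formula; 2 cancels the 1/2 there,
    and 2^k is for [Gamma_rising2]. *)
Lemma Psi_coefE m k : (k <= m)%N -> Psi_coef m k =
  mellin_coef m k / Num.sqrt (2 * pi) * 2 * 2 ^+ k *
  ((k.*2)`!%:R / (4 ^+ k * k`!%:R) * Num.sqrt pi).
Proof.
move=> km; rewrite /Psi_coef /mellin_coef sqrtrM// -(bin_fact km) !natrM.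
have -> : (2 : R) ^+ k.*2 = 4 ^+ k by rewrite -mul2n exprM -natrX.
have p0 : Num.sqrt pi != 0 :> R by rewrite gt_eqF// sqrtr_gt0 pi_gt0.
have t0 : Num.sqrt 2 != 0 :> R by rewrite gt_eqF// sqrtr_gt0.
have f0 j : (j`!%:R : R) != 0 by rewrite pnatr_eq0 -lt0n fact_gt0.
have e0 : (4 : R) ^+ k != 0 by rewrite expf_neq0.
have t2 : Num.sqrt 2 * Num.sqrt 2 = 2 :> R by rewrite -expr2 sqr_sqrtr.
(* Writing sqrt 2 as 2 / sqrt 2 moves the root to the denominator, where the target has sqrt(2
   pi). *)
transitivity ('C(m, k)%:R * (-1) ^+ (m - k) * 2 ^+ k *
  ((Num.sqrt 2 * Num.sqrt 2) / Num.sqrt 2) : R); first by field.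
rewrite t2; move: (4 ^+ k) e0 => d e0.
by field; rewrite p0 t0 e0 !f0.
Qed.

(** For z = s + 2k and w = 2k + 1, the condition Re z < w is exactly Re s < 1. *)
Lemma mellin_beta_fun k s : 0 < complex.Re s -> complex.Re s < 1 ->
  mellin_integrable (beta_fun k) (s + (k.*2)%:R) /\
  Gamma ((k.*2.+1)%:R%:C / 2) * mellin (beta_fun k) (s + (k.*2)%:R) =
    2^-1 * Gamma (s / 2 + k%:R) * Gamma ((1 - s) / 2).
Proof.
move=> s0 s1.
have sk0 : 0 < complex.Re (s + (k.*2)%:R) by rewrite ReD Re_nat ltr_wpDr.
have skw : complex.Re (s + (k.*2)%:R) < (k.*2.+1)%:R.
  by rewrite ReD Re_nat -natr1 addrC ltrD2l.
have GN0 : Gamma ((k.*2.+1)%:R%:C / 2) != 0 :> R[i].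
  rewrite Gamma_half_nat; apply/eqP => /complexI/eqP; apply/negP.
  rewrite gt_eqF//; apply: mulr_gt0; last by rewrite sqrtr_gt0 pi_gt0.
  apply: divr_gt0.
    by rewrite ltr0n fact_gt0.
  by apply: mulr_gt0; [exact: exprn_gt0|rewrite ltr0n fact_gt0].
have [intb bE] := mellin_beta sk0 skw GN0.
split; first exact: intb.
have -> : s / 2 + k%:R = (s + (k.*2)%:R) / 2 by rewrite -muln2 natrM; field.
have -> : 1 - s = (k.*2.+1)%:R%:C - (s + (k.*2)%:R).
  by rewrite rmorph_nat -natr1; ring.
exact: bE.
Qed.

End mellin_polynomial.

Theorem lemma3 (R : realType) (m : nat) (s : R[i])
    (hs0 : 0 < complex.Re s) (hs1 : complex.Re s < 1) :
  mellin_integrable (@Psi R m) s /\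
  mellin (@Psi R m) s =
    (Num.sqrt (2 * pi))^-1%:C * Gamma (s / 2) * Gamma ((1 - s) / 2) *
    ceval (Qpoly R m) s.
Proof.
have bint k := mellinXn (mellin_beta_fun k hs0 hs1).1.
have [intPsi ->] := mellin_sum (fun t _ => @PsiE R m t) (fun k _ => (bint k).1).
split; first exact: intPsi.
rewrite Qpoly_explicit ceval_explicit_Qpoly mulr_sumr; apply: eq_bigr => k _.
rewrite (bint k).2; have [_] := mellin_beta_fun k hs0 hs1; rewrite Gamma_half_nat.
(* [g] is the closed value of Gamma((2k+1)/2), common to the Beta identity and to the coefficient;
   once shared, its value is forgotten. *)
rewrite (Psi_coefE (ltn_ord k : (k <= m)%N)); set g : R := _ / _ * _.
clearbody g.
rewrite (realcM _ g) (realcM _ (2 ^+ k)) (realcM _ 2) (realcM (mellin_coef m k)).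
rewrite rmorphXn/= -natc.
have := Gamma_rising2 k hs0.
move: (Gamma (s / 2 + k%:R)) (Gamma (s / 2)) (Gamma ((1 - s) / 2)).
move: (mellin _ _) (mellin_coef m k : R)%:C (_^-1)%:C g%:C (rising2 s k) ((2 : R[i]) ^+ k).
move=> M c r G p e g1 g0 g2 GR GM.
(* Isolating [G * M] lets the Beta identity [GM] apply; grouping [e * g1] then calls [GR]. *)
transitivity (c * r * 2 * e * (G * M)); first by ring.
rewrite GM; transitivity (c * r * (e * g1) * g2); first by field.
by rewrite GR; ring.
Qed.
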